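(* There exists a unitary $d\in\mathcal{D}_2$ such that the corresponding automorphism $\lambda_d\in\operatorname{Aut}(\mathcal{O}_2)$ satisfies the following properties: (1) $\lambda_d$ extends to an automorphism of $\mathcal{Q}_2$; (2) $\lambda_d(x)=x$ for all $x\in C^*(\mathcal{D}_2,s_2)$; (3) $\lambda_d$ does not lie in the subgroup of $\operatorname{Aut}(\mathcal{O}_2)$ generated by the flip-flop $\sigma$, the gauge automorphisms $\alpha_t$ ($t\in\mathbb{T}$), and the inner automorphisms.
   Context: The 2-adic ring $C^*$-algebra $\mathcal{Q}_2$ is the universal unital $C^*$-algebra generated by a unitary $u$ and an isometry $s_2$ with $s_2u=u^2s_2$ and $s_2s_2^*+us_2s_2^*u^*=1$. Put $s_1:=us_2$; then $\mathcal{O}_2:=C^*(s_1,s_2)\subseteq\mathcal{Q}_2$ is the canonical copy of the Cuntz algebra. $\mathcal{D}_2\subseteq\mathcal{O}_2$ is the diagonal subalgebra, generated by the projections $s_{\mu}s_{\mu}^*$ with $s_\mu=s_{\mu_1}\cdots s_{\mu_k}$, $\mu_j\in\{1,2\}$. For a unitary $V\in\mathcal{O}_2$, $\lambda_V$ is the unital $*$-endomorphism of $\mathcal{O}_2$ with $\lambda_V(s_i)=Vs_i$ ($i=1,2$); for unitary $d\in\mathcal{D}_2$, $\lambda_d$ is an automorphism of $\mathcal{O}_2$. On $\mathcal{O}_2$, the flip-flop $\sigma$ is the automorphism $s_1\mapsto s_2$, $s_2\mapsto s_1$; the gauge automorphism $\alpha_t$ is $s_i\mapsto ts_i$ ($i=1,2$);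 inner automorphisms are $x\mapsto wxw^*$ with $w$ a unitary of $\mathcal{O}_2$. $C^*(\mathcal{D}_2,s_2)$ is the $C^*$-algebra generated by $\mathcal{D}_2$ and $s_2$. *)

(* Defs.v *)
From HB Require Import structures.
From mathcomp Require Import all_boot all_order all_algebra.
From mathcomp Require Import complex.
From mathcomp Require Import all_classical all_reals all_analysis.

Set Implicit Arguments.
Unset Strict Implicit.
Unset Printing Implicit Defensive.

Import Order.TTheory GRing.Theory Num.Theory.
Import numFieldNormedType.Exports.
Import Normc.

Local Open Scope classical_set_scope.
Local Open Scope complex_scope.
Local Open Scope ring_scope.

Definition norm_cvg (R : realType) (A : zmodType) (N : A -> R) (x : nat -> A)
    (l : A) : Prop :=
  (fun n => N (x n - l)) @ \oo --> (0 : R).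

Definition norm_cauchy (R : realType) (A : zmodType) (N : A -> R)
    (x : nat -> A) : Prop :=
  forall e : R, 0 < e -> exists n0 : nat,
    forall m n, (n0 <= m)%N -> (n0 <= n)%N -> N (x m - x n) < e.

(* Unital complex C*-algebras.  The norm is a field of this structure, and is
   not taken from completeNormedModType, because Hierarchy Builder rejects any
   join of the classes of rings and of normed modules declared after
   numDomainType. *)
HB.mixin Record isCStarAlgebra (R : realType) (A : Type)
    & GRing.Algebra R[i] A := {
  cnorm : A -> R;
  star : A -> A;
  cnorm_eq0 : forall x : A, cnorm x = 0 -> x = 0;
  cnormD : forall x y : A, cnorm (x + y) <= cnorm x + cnorm y;
  cnormZ : forall (a : R[i]) (x : A), cnorm (a *: x) = normc a * cnorm x;
  cnorm_complete : forall x : nat -> A, norm_cauchy cnorm x ->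
    exists l : A, norm_cvg cnorm x l;
  cnormM : forall x y : A, cnorm (x * y) <= cnorm x * cnorm y;
  starD : forall x y : A, star (x + y) = star x + star y;
  starZ : forall (a : R[i]) (x : A), star (a *: x) = conjc a *: star x;
  starM : forall x y : A, star (x * y) = star y * star x;
  starK : forall x : A, star (star x) = x;
  cnorm_star : forall x : A, cnorm (star x * x) = cnorm x ^+ 2
}.

#[short(type="cstarAlgType")]
HB.structure Definition CStarAlgebra (R : realType) :=
  {A of GRing.Algebra R[i] A & isCStarAlgebra R A}.

Definition unitary (R : realType) (A : cstarAlgType R) (x : A) : Prop :=
  star x * x = 1 /\ x * star x = 1.

Definition isometry (R : realType) (A : cstarAlgType R) (x : A) : Prop :=
  star x * x = 1.

Definition cstar_subalgebra (R : realType) (A : cstarAlgType R) (B : set A)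
    : Prop :=
  [/\ B 0 /\ (forall x y, B x -> B y -> B (x + y)),
      forall (a : R[i]) x, B x -> B (a *: x),
      forall x y, B x -> B y -> B (x * y),
      forall x, B x -> B (star x)
    & forall (x : nat -> A) (l : A),
        (forall n, B (x n)) -> norm_cvg cnorm x l -> B l].

(* C*(X) *)
Definition cstar_gen (R : realType) (A : cstarAlgType R) (X : set A) : set A :=
  [set x | forall B : set A, cstar_subalgebra B -> X `<=` B -> B x].

(* Homomorphisms and automorphisms of a C*-subalgebra D of A are given by
   functions on the whole of A, whose values outside D are irrelevant; two of
   them are the same when they agree on D.  All the subalgebras D considered
   contain the unit of A. *)
Definition star_hom (R : realType) (A B : cstarAlgType R) (D : set A)
    (f : A -> B) : Prop :=
  [/\ forall x y, D x -> D y -> f (x + y) = f x + f y,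
      forall (a : R[i]) x, D x -> f (a *: x) = a *: f x,
      forall x y, D x -> D y -> f (x * y) = f x * f y,
      forall x, D x -> f (star x) = star (f x)
    & f 1 = 1].

Definition star_endo (R : realType) (A : cstarAlgType R) (D : set A)
    (f : A -> A) : Prop :=
  star_hom D f /\ set_fun D D f.

Definition star_aut (R : realType) (A : cstarAlgType R) (D : set A)
    (f : A -> A) : Prop :=
  star_hom D f /\ set_bij D D f.

(* The subgroup generated by a set S of bijections of D onto itself, up to
   equality on D. *)
Inductive generated_subgroup (T : Type) (D : set T) (S : set (T -> T))
    : (T -> T) -> Prop :=
| gen_mem f : S f -> generated_subgroup D S f
| gen_id : generated_subgroup D S id
| gen_comp f g : generated_subgroup D S f -> generated_subgroup D S g ->
    generated_subgroup D S (f \o g)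
| gen_inv f g : generated_subgroup D S f -> {in D, cancel f g} ->
    generated_subgroup D S g
| gen_ext f g : generated_subgroup D S f -> {in D, f =1 g} ->
    generated_subgroup D S g.

Definition Q2_relations (R : realType) (A : cstarAlgType R) (u s : A) : Prop :=
  [/\ unitary u, isometry s, s * u = u ^+ 2 * s
    & s * star s + u * s * star s * star u = 1].

(* (A, u, s) is the 2-adic ring C*-algebra with its canonical generators: the
   universal unital C*-algebra on the relations above, determined up to a
   unique isomorphism.  The homomorphism f is unique since u and s generate. *)
Definition is_Q2 (R : realType) (A : cstarAlgType R) (u s : A) : Prop :=
  [/\ Q2_relations u s,
      cstar_gen [set u; s] = setT
    & forall (B : cstarAlgType R) (v t : B), Q2_relations v t ->
        exists f : A -> B, [/\ star_hom setT f, f u = v & f s = t]].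

Section Cuntz.
Variables (R : realType) (A : cstarAlgType R) (s1 s2 : A).

Definition O2 : set A := cstar_gen [set s1; s2].

(* The letters 1 and 2 are encoded by false and true. *)
Definition s_word (mu : seq bool) : A := \prod_(b <- mu) (if b then s2 else s1).

Definition D2 : set A :=
  cstar_gen [set p | exists mu, p = s_word mu * star (s_word mu)].

Definition is_lambda (V : A) (f : A -> A) : Prop :=
  [/\ star_endo O2 f, f s1 = V * s1 & f s2 = V * s2].

Definition is_flip_flop (f : A -> A) : Prop :=
  [/\ star_aut O2 f, f s1 = s2 & f s2 = s1].

Definition is_gauge (t : R[i]) (f : A -> A) : Prop :=
  [/\ star_aut O2 f, f s1 = t *: s1 & f s2 = t *: s2].

Definition is_inner (f : A -> A) : Prop :=
  exists w : A, [/\ O2 w, unitary w & forall x, O2 x -> f x = w * x * star w].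

Definition flip_gauge_inner : set (A -> A) :=
  [set f | [\/ is_flip_flop f, exists2 t : R[i], `|t| = 1 & is_gauge t f
             | is_inner f]].

End Cuntz.

(* Main.v *)
(* Identify D_2 with C(Z_2), u acting by translation by 1 and s_2 by
   doubling.  If f : Z_2 -> T is continuous and f(2 x) f(2 x - 1) = f(x), i.e.
   f (u f u^-1) s_2 = s_2 f, then u |-> f u, s_2 |-> s_2 preserves the relations
   of Q_2 and defines an automorphism, with inverse given by the conjugate of
   f, which fixes D_2 and s_2 and restricts to lambda_d for
   d = f s_1 s_1^* + s_2 s_2^*.  A solution is
   f(x) = exp(i pi sum_k 2^-k (-1)^ceil(x / 2^k)); it has f(3) = -1.
   Modulo inner automorphisms, an element of the subgroup generated by the
   flip-flop, the gauge and the inner automorphisms is alpha_t sigma^e, hence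
   sends s_i to t w s_i' w^* for a unitary w of O_2.  Compressing polynomials
   in s_1, s_2 that approximate w by large powers of s_2 (and s_1) shows, for
   an element which fixes s_2 and s_1 s_1^*, that e = 0, t = 1 and
   s_1^* w s_1 is a limit of scalars.  Such an element sends s_1 s_1 s_1^* to
   itself, which would force f = 1 on 3 + 4 Z_2. *)
Require Import Defs.
From HB Require Import structures.
From mathcomp Require Import all_boot all_order all_algebra.
From mathcomp Require Import complex.
From mathcomp Require Import all_classical all_reals all_analysis.
From mathcomp Require Import ring lra zify.

Set Implicit Arguments.
Unset Strict Implicit.
Unset Printing Implicit Defensive.

Import Order.TTheory GRing.Theory Num.Theory.
Import numFieldNormedType.Exports.

Local Open Scope classical_set_scope.
Local Open Scope complex_scope.
Local Open Scope ring_scope.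

(** * C*-algebras and bounded homomorphisms *)

Section CStarBasics.
Variables (R : realType) (A : cstarAlgType R).
Implicit Types (x y z l m : A) (a c : R[i]) (k n : nat).

Lemma normc_real (r : R) : Normc.normc (r%:C) = `|r|.
Proof. by rewrite /Normc.normc /= expr0n addr0 sqrtr_sqr. Qed.

Lemma normc_ge0 a : 0 <= Normc.normc a.
Proof. by case: a => x y; exact: sqrtr_ge0. Qed.

Lemma normcX a k : Normc.normc a = 1 -> Normc.normc (a ^+ k) = 1.
Proof.
move=> a1; elim: k => [|k IH]; first exact: Normc.normc1.
by rewrite exprS Normc.normcM a1 IH mulr1.
Qed.

Lemma normc_conj_mul a : Normc.normc a = 1 -> a * conjc a = 1.
Proof.
case: a => x y /= /(congr1 (fun r : R => r ^+ 2)).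
rewrite sqr_sqrtr; last first.
  by rewrite addr_ge0 // sqr_ge0.
move=> h; apply/eqP; rewrite eq_complex /=; apply/andP; split;
  apply/eqP; last by ring.
by rewrite -(expr1n _ 2) -h; ring.
Qed.

Lemma cnorm0 : cnorm (0 : A) = 0.
Proof. by rewrite -(scale0r (0 : A)) cnormZ Normc.normc0 mul0r. Qed.

Lemma cnormN x : cnorm (- x) = cnorm x.
Proof. by rewrite -scaleN1r cnormZ normcN Normc.normc1 mul1r. Qed.

Lemma cnorm_ge0 x : 0 <= cnorm x.
Proof.
have := cnormD x (- x); rewrite subrr cnorm0 cnormN => h; lra.
Qed.

Lemma cnormB x y : cnorm (x - y) <= cnorm x + cnorm y.
Proof. by rewrite -(cnormN y) cnormD. Qed.

Lemma cnorm_distC x y : cnorm (x - y) = cnorm (y - x).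
Proof. by rewrite -cnormN opprB. Qed.

Lemma cnorm_dist_add y x z : cnorm (x - z) <= cnorm (x - y) + cnorm (y - z).
Proof. by rewrite -(subrKA y); exact: cnormD. Qed.

Lemma star0 : star (0 : A) = 0.
Proof. by rewrite -(scale0r (0 : A)) starZ conjc0 !scale0r. Qed.

Lemma starN x : star (- x) = - star x.
Proof. by apply/eqP; rewrite -addr_eq0 -starD addNr star0. Qed.

Lemma starB x y : star (x - y) = star x - star y.
Proof. by rewrite starD starN. Qed.

Lemma star1 : star (1 : A) = 1.
Proof.
by rewrite -[LHS]mulr1 -{2}(starK (1 : A)) -starM mulr1 starK.
Qed.

Lemma cnorm_starE x : cnorm (star x) = cnorm x.
Proof.
suff le y : cnorm y <= cnorm (star y).
  by apply/le_anti; rewrite le andbT -{2}(starK x) le.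
have := cnormM (star y) y; rewrite cnorm_star expr2.
have := cnorm_ge0 y; rewrite le_eqVlt => /predU1P[<- _|y0].
  exact: cnorm_ge0.
by rewrite ler_pM2r.
Qed.

Lemma cnorm1 : cnorm (1 : A) = 1.
Proof.
have := cnorm_star (1 : A); rewrite mulr1 star1 expr2 => h.
have n0 : cnorm (1 : A) != 0.
  by apply/eqP => /cnorm_eq0 /eqP; rewrite oner_eq0.
by apply: (mulfI n0); rewrite mulr1.
Qed.

Lemma cnorm_isometry x : Defs.isometry x -> cnorm x = 1.
Proof.
move=> xx; have := cnorm_star x; rewrite xx cnorm1 => /esym/eqP.
rewrite sqrf_eq1 => /orP[/eqP //|/eqP x1].
by have := cnorm_ge0 x; rewrite x1 => ?; lra.
Qed.

Lemma cnorm_isometryM x y : Defs.isometry x -> cnorm (x * y) = cnorm y.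
Proof.
move=> xx; apply/le_anti/andP; split.
  by rewrite (le_trans (cnormM _ _)) // cnorm_isometry // mul1r.
have {1}-> : y = star x * (x * y) by rewrite mulrA xx mul1r.
by rewrite (le_trans (cnormM _ _)) // cnorm_starE cnorm_isometry // mul1r.
Qed.

Lemma unitary_star x : unitary x -> unitary (star x).
Proof. by case=> x1 x2; split; rewrite starK. Qed.

Lemma unitaryM x y : unitary x -> unitary y -> unitary (x * y).
Proof.
move=> [x1 x2] [y1 y2]; split; rewrite starM.
  by rewrite mulrA -(mulrA _ _ x) x1 mulr1.
by rewrite mulrA -(mulrA x) y2 mulr1.
Qed.

Lemma unitary1 : unitary (1 : A).
Proof. by split; rewrite star1 mulr1. Qed.

Lemma isometryX x k : Defs.isometry x -> Defs.isometry (x ^+ k).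
Proof.
move=> xx; elim: k => [|k IH].
  by rewrite /Defs.isometry expr0 star1 mulr1.
by rewrite /Defs.isometry exprSr starM mulrA -(mulrA _ (star _)) IH mulr1.
Qed.

Lemma isometryM x y : Defs.isometry x -> Defs.isometry y ->
  Defs.isometry (x * y).
Proof.
by move=> xx yy; rewrite /Defs.isometry starM -mulrA (mulrA _ x) xx mul1r.
Qed.

Lemma cnorm_isometry_compress x y z : Defs.isometry x -> Defs.isometry z ->
  cnorm (star x * y * z) <= cnorm y.
Proof.
move=> xx zz; rewrite (le_trans (cnormM _ _)) // (cnorm_isometry zz) mulr1.
by rewrite (le_trans (cnormM _ _)) // cnorm_starE (cnorm_isometry xx) mul1r.
Qed.

Lemma conj_mul x y z : x * (y * z * star y) * star x = x * y * z * star (x * y).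
Proof. by rewrite starM !mulrA. Qed.

Lemma star_bool (n : bool) : star (n%:R : A) = n%:R.
Proof. by case: n; rewrite ?star0 ?star1. Qed.

Lemma intertwineX x y a k z :
  x * z = a *: (z * y) -> x ^+ k * z = a ^+ k *: (z * y ^+ k).
Proof.
move=> h; elim: k => [|k IH]; first by rewrite !expr0 mul1r mulr1 scale1r.
rewrite exprSr -mulrA h -scalerAr mulrA IH -scalerAl scalerA.
by rewrite -mulrA -exprSr -exprS.
Qed.

Lemma norm_cvg_squeeze (x : nat -> A) l (r : nat -> R) :
  (forall n, cnorm (x n - l) <= r n) -> r @ \oo --> (0 : R) ->
  norm_cvg cnorm x l.
Proof.
move=> h r0; apply: (squeeze_cvgr _ (@cvg_cst _ _ _ _ _) r0).
by near=> n; rewrite cnorm_ge0 h.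
Unshelve. all: end_near. Qed.

End CStarBasics.

(** * Norm limits and generated C*-subalgebras *)

Section Limits.
Variables (R : realType) (A : cstarAlgType R).
Implicit Types (x y z l m : A) (a c : R[i]).

Lemma norm_cvg_uniq (x : nat -> A) l m :
  norm_cvg cnorm x l -> norm_cvg cnorm x m -> l = m.
Proof.
move=> xl xm; apply/eqP; rewrite -subr_eq0; apply/eqP/cnorm_eq0/le_anti.
rewrite cnorm_ge0 andbT.
have h : (fun n => cnorm (x n - l) + cnorm (x n - m)) @ \oo --> (0 : R).
  by rewrite -[0]addr0; apply: cvgD.
apply: (ler_cvg_to (@cvg_cst _ _ _ _ _) h).
near=> n; rewrite (cnorm_distC (x n) l); exact: cnorm_dist_add.
Unshelve. all: end_near. Qed.

Lemma norm_cvg_cst x : norm_cvg cnorm (fun=> x) x.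
Proof.
by rewrite /norm_cvg subrr cnorm0; apply: cvg_cst.
Qed.

Lemma norm_cvgD (x y : nat -> A) l m :
  norm_cvg cnorm x l -> norm_cvg cnorm y m ->
  norm_cvg cnorm (fun n => x n + y n) (l + m).
Proof.
move=> xl ym.
apply: (norm_cvg_squeeze (r := fun n => cnorm (x n - l) + cnorm (y n - m))).
  by move=> n; rewrite opprD addrACA cnormD.
by rewrite -[0]addr0; apply: cvgD.
Qed.

Lemma norm_cvgM (x y : nat -> A) l m :
  norm_cvg cnorm x l -> norm_cvg cnorm y m ->
  norm_cvg cnorm (fun n => x n * y n) (l * m).
Proof.
move=> xl ym.
apply: (norm_cvg_squeeze (r := fun n =>
  cnorm (x n - l) * (cnorm (y n - m) + cnorm m) + cnorm l * cnorm (y n - m))).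
  move=> n; have -> : x n * y n - l * m = (x n - l) * y n + l * (y n - m).
    by rewrite mulrBl mulrBr addrA subrK.
  apply: le_trans (cnormD _ _) _; apply: lerD; last exact: cnormM.
  apply: le_trans (cnormM _ _) _; rewrite ler_wpM2l ?cnorm_ge0 //.
  by rewrite -{1}(subrK m (y n)) cnormD.
rewrite -[0]addr0; apply: cvgD; last first.
  by rewrite -(mulr0 (cnorm l)); apply: cvgM ym; apply: cvg_cst.
rewrite -(mul0r (0 + cnorm m)); apply: cvgM xl _.
by apply: cvgD ym _; apply: cvg_cst.
Qed.

Lemma norm_cvg_bounded_map (B : cstarAlgType R) (T : A -> B) (K : R)
    (x : nat -> A) l :
  (forall x y, T (x - y) = T x - T y) ->
  (forall x, cnorm (T x) <= K * cnorm x) ->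
  norm_cvg cnorm x l -> norm_cvg cnorm (fun n => T (x n)) (T l).
Proof.
move=> TB TK xl.
apply: (norm_cvg_squeeze (r := fun n => K * cnorm (x n - l))).
  by move=> n; rewrite -TB TK.
by rewrite -(mulr0 K); apply: cvgM xl; apply: cvg_cst.
Qed.

Lemma norm_cvg_star (x : nat -> A) l :
  norm_cvg cnorm x l -> norm_cvg cnorm (fun n => star (x n)) (star l).
Proof.
apply: (@norm_cvg_bounded_map A star 1); first exact: starB.
by move=> y; rewrite mul1r cnorm_starE.
Qed.

Lemma norm_cvgMl y (x : nat -> A) l :
  norm_cvg cnorm x l -> norm_cvg cnorm (fun n => y * x n) (y * l).
Proof. exact/norm_cvgM/norm_cvg_cst. Qed.

Lemma norm_cvgMr y (x : nat -> A) l :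
  norm_cvg cnorm x l -> norm_cvg cnorm (fun n => x n * y) (l * y).
Proof. by move=> xl; apply: norm_cvgM (norm_cvg_cst y). Qed.

Lemma norm_cvg_shift (x : nat -> A) l :
  norm_cvg cnorm x l -> norm_cvg cnorm (fun n => x n.+1) l.
Proof. by rewrite /norm_cvg -(cvg_shiftS (fun n => cnorm (x n - l))). Qed.

Lemma cvg_half (K : R) : (fun n => K * 2^-1 ^+ n) @ \oo --> (0 : R).
Proof. by apply: cvg_geometric; rewrite ger0_norm ?invr_ge0 //; lra. Qed.

Lemma norm_cvg_geometric (x : nat -> A) (K : R) :
  (forall n, cnorm (x n.+1 - x n) <= K * 2^-1 ^+ n) ->
  exists l, norm_cvg cnorm x l /\
    forall n, cnorm (x n - l) <= 2 * K * 2^-1 ^+ n.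
Proof.
move=> h.
have K0 : 0 <= K.
  by have := h 0%N; rewrite expr0 mulr1; exact/le_trans/cnorm_ge0.
have tail n k : cnorm (x (n + k)%N - x n) <= 2 * K * 2^-1 ^+ n.
  (* The sharper bound, a partial geometric sum, is the one that passes through the induction on
     [k]. *)
  suff : cnorm (x (n + k)%N - x n) <= 2 * K * (2^-1 ^+ n - 2^-1 ^+ (n + k)).
    move=> /le_trans; apply; rewrite ler_wpM2l ?mulr_ge0 // gerBl.
    by rewrite exprn_ge0 // invr_ge0.
  elim: k => [|k IH]; first by rewrite addn0 !subrr cnorm0 mulr0.
  rewrite addnS; apply: le_trans (cnorm_dist_add (x (n + k)%N) _ _) _.
  apply: le_trans (lerD (h _) IH) _; rewrite exprS.
  by rewrite le_eqVlt; apply/orP; left; apply/eqP; field.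
have [|l xl] := cnorm_complete x.
  move=> e e0; have e20 : 0 < e / 2 by rewrite divr_gt0.
  have /cvgr0Pnorm_lt /(_ _ e20) [n0 _ hn0] := cvg_half (2 * K).
  have ltn0 k : cnorm (x (n0 + k)%N - x n0) < e / 2.
    apply: le_lt_trans (tail _ _) _; apply: le_lt_trans (ler_norm _) _.
    exact/(hn0 n0)/leqnn.
  exists n0 => i j /subnKC <- /subnKC <-.
  apply: le_lt_trans (cnorm_dist_add (x n0) _ _) _.
  by rewrite (cnorm_distC (x n0)) (splitr e); apply: ltrD.
exists l; split=> // n.
have xnl : (fun k => 2 * K * 2^-1 ^+ n + cnorm (x (n + k)%N - l)) @ \oo
    --> 2 * K * 2^-1 ^+ n.
  rewrite -[X in _ --> X]addr0; apply: cvgD; first exact: cvg_cst.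
  move: xl; rewrite /norm_cvg -(cvg_shiftn n) => xl.
  by under eq_fun do rewrite addnC.
apply: (ler_cvg_to (@cvg_cst _ _ _ _ _) xnl); near=> k.
apply: le_trans (cnorm_dist_add (x (n + k)%N) _ _) _.
by rewrite lerD2r cnorm_distC tail.
Unshelve. all: end_near. Qed.

Section Closure.
Variables (B : set A) (BB : cstar_subalgebra B).

Lemma subalg0 : B 0. Proof. by case: BB => -[]. Qed.

Lemma subalgD x y : B x -> B y -> B (x + y).
Proof. by case: BB => -[_ h] _ _ _ _; apply: h. Qed.

Lemma subalgZ a x : B x -> B (a *: x).
Proof. by case: BB => _ h _ _ _; apply: h. Qed.

Lemma subalgM x y : B x -> B y -> B (x * y).
Proof. by case: BB => _ _ h _ _; apply: h. Qed.

Lemma subalg_star x : B x -> B (star x).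
Proof. by case: BB => _ _ _ h _; apply: h. Qed.

Lemma subalg_cvg (x : nat -> A) l :
  (forall n, B (x n)) -> norm_cvg cnorm x l -> B l.
Proof. by case: BB => _ _ _ _; apply. Qed.

Lemma subalgN x : B x -> B (- x).
Proof. by rewrite -scaleN1r; apply: subalgZ. Qed.

Lemma subalgB x y : B x -> B y -> B (x - y).
Proof. by move=> Bx By; apply/subalgD/subalgN. Qed.

End Closure.

Lemma cstar_gen_subalgebra (X : set A) : cstar_subalgebra (cstar_gen X).
Proof.
split.
- split=> [B BB _|x y hx hy B BB XB]; first exact: subalg0.
  by apply: subalgD => //; [apply: hx|apply: hy].
- by move=> a x hx B BB XB; apply: subalgZ => //; apply: hx.
- by move=> x y hx hy B BB XB; apply: subalgM => //; [apply: hx|apply: hy].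
- by move=> x hx B BB XB; apply: subalg_star => //; apply: hx.
by move=> x l hx xl B BB XB; apply: subalg_cvg xl => // n; apply: hx.
Qed.

Lemma cstar_gen_incl (X : set A) : X `<=` cstar_gen X.
Proof. by move=> x Xx B _; apply. Qed.

Lemma cstar_gen_sub (X B : set A) :
  cstar_subalgebra B -> X `<=` B -> cstar_gen X `<=` B.
Proof. by move=> BB XB x; apply. Qed.

Lemma commutant_subalgebra (X : set A) : (forall x, X x -> X (star x)) ->
  cstar_subalgebra [set y | forall x, X x -> x * y = y * x].
Proof.
move=> Xs; split=> /=.
- split=> [x _|x y hx hy z Xz]; first by rewrite mul0r mulr0.
  by rewrite mulrDr mulrDl hx // hy.
- by move=> a x hx y Xy; rewrite -scalerAr hx // scalerAl.
- by move=> x y hx hy z Xz; rewrite mulrA hx // -mulrA hy // mulrA.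
- by move=> x hx y Xy; rewrite -(starK y) -!starM hx //; apply: Xs.
move=> x l hx xl y Xy; apply: norm_cvg_uniq (norm_cvgMl y xl) _.
under eq_fun do rewrite hx //.
exact: norm_cvgMr.
Qed.

(** The commutant is taken twice: the commutant of [X] is a C*-subalgebra containing [X], hence
    [cstar_gen X]; then the commutant of [cstar_gen X] contains [X], hence [cstar_gen X] again. *)
Lemma cstar_gen_commutative (X : set A) :
  (forall x, X x -> star x = x) -> (forall x y, X x -> X y -> x * y = y * x) ->
  forall x y, cstar_gen X x -> cstar_gen X y -> x * y = y * x.
Proof.
move=> Xsa XC.
have Xcomm x y : X x -> cstar_gen X y -> x * y = y * x.
  move=> Xx Xy; apply: (cstar_gen_sub (commutant_subalgebra _) _ Xy) Xx.
    by move=> {}x Xx; rewrite Xsa.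
  by move=> z Xz t Xt; apply: XC.
move=> x y Xx Xy.
apply: (cstar_gen_sub (commutant_subalgebra (X := cstar_gen X) _) _ Xy) Xx.
  by move=> z; apply: subalg_star; apply: cstar_gen_subalgebra.
by move=> z Xz t Xt; apply/esym/Xcomm.
Qed.

End Limits.

(** * Continuity of homomorphisms *)

Section BoundedHom.
Variables (R : realType).
Implicit Types A B C : cstarAlgType R.

(** Continuity is what matters, so any constant [K] is accepted. The unit may move, so that
    [x |-> v x v^*] with [v] an isometry is an instance. *)
Definition bounded_hom A B (T : A -> B) : Prop :=
  [/\ forall x y, T (x + y) = T x + T y,
      forall (a : R[i]) x, T (a *: x) = a *: T x,
      forall x y, T (x * y) = T x * T y,
      forall x, T (star x) = star (T x)
    & exists K : R, forall x, cnorm (T x) <= K * cnorm x].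

Lemma bounded_hom0 A B (T : A -> B) : bounded_hom T -> T 0 = 0.
Proof. by case=> _ TZ _ _ _; rewrite -(scale0r 0) TZ !scale0r. Qed.

Lemma bounded_hom_cvg A B (T : A -> B) (x : nat -> A) l : bounded_hom T ->
  norm_cvg cnorm x l -> norm_cvg cnorm (fun n => T (x n)) (T l).
Proof.
case=> TD TZ _ _ [K TK]; apply: norm_cvg_bounded_map TK => y z.
by rewrite TD -scaleN1r TZ scaleN1r.
Qed.

Lemma preimage_subalgebra A B (T : A -> B) (D : set B) : bounded_hom T ->
  cstar_subalgebra D -> cstar_subalgebra (T @^-1` D).
Proof.
move=> hT DD; have Tc := bounded_hom_cvg hT; have T0 := bounded_hom0 hT.
case: hT => TD TZ TM Ts _; split=> /=.
- rewrite /preimage /= T0; split=> [|x y hx hy]; first exact: subalg0.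
  by rewrite TD; exact: subalgD.
- by move=> a x hx; rewrite /preimage /= TZ; apply: subalgZ.
- by move=> x y hx hy; rewrite /preimage /= TM; apply: subalgM.
- by move=> x hx; rewrite /preimage /= Ts; apply: subalg_star.
by move=> x l hx /Tc; apply: subalg_cvg.
Qed.

Lemma bounded_hom_gen A B (T : A -> B) (X : set A) (D : set B) :
  bounded_hom T -> cstar_subalgebra D -> (forall x, X x -> D (T x)) ->
  forall x, cstar_gen X x -> D (T x).
Proof.
by move=> hT DD XD x; apply: (cstar_gen_sub (preimage_subalgebra hT DD)).
Qed.

Lemma bounded_hom_fix A (T : A -> A) (X : set A) : bounded_hom T ->
  (forall x, X x -> T x = x) -> forall x, cstar_gen X x -> T x = x.
Proof.
move=> hT XT; apply: (cstar_gen_sub (B := [set x | T x = x])) => //.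
have Tc := bounded_hom_cvg hT; have T0 := bounded_hom0 hT.
case: hT => TD TZ TM Ts _; split=> /=.
- by split=> // x y hx hy; rewrite TD hx hy.
- by move=> a x hx; rewrite TZ hx.
- by move=> x y hx hy; rewrite TM hx hy.
- by move=> x hx; rewrite Ts hx.
move=> y l hy yl; apply: norm_cvg_uniq (Tc _ _ yl) _.
by under eq_fun do rewrite hy.
Qed.

Lemma bounded_hom_conj A (v : A) : Defs.isometry v ->
  bounded_hom (fun x => v * x * star v).
Proof.
move=> vv; split.
- by move=> x y; rewrite mulrDr mulrDl.
- by move=> a x; rewrite -scalerAr -scalerAl.
- by move=> x y; rewrite !mulrA -(mulrA (v * x) (star v) v) vv mulr1.
- by move=> x; rewrite !starM starK !mulrA.
exists 1 => x; rewrite mul1r (le_trans (cnormM _ _)) // cnorm_starE.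
by rewrite (cnorm_isometry vv) mulr1 cnorm_isometryM.
Qed.

(* Solving z = g^2 + z^2 by iteration produces k = 1 - 2 z, a square root of
   1 - (2 g)^2 which commutes with g; so 2 g is the real part of the unitary
   2 g + i k. *)
Lemma selfadjoint_sqrt A (g : A) : star g = g -> cnorm g <= 4^-1 ->
  exists k : A, [/\ star k = k, k * g = g * k & k * k = 1 - (g + g) * (g + g)].
Proof.
move=> gs gn;
pose z := fix z n : A := if n is n'.+1 then g * g + z n' * z n' else 0.
(* The ball of radius 1/8 is stable, as 1/16 + 1/64 <= 1/8; on it the iteration contracts distances
   by 1/4, better than the ratio 1/2 needed for convergence. *)
have zn n : cnorm (z n) <= 8^-1.
  elim: n => [|n IH] /=; first by rewrite cnorm0; lra.
  apply: le_trans (cnormD _ _) _.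
  have := cnormM g g; have := cnormM (z n) (z n).
  have := cnorm_ge0 g; have := cnorm_ge0 (z n); nra.
have [|l [zl _]] := @norm_cvg_geometric _ _ z 1.
  elim=> [|n IH].
    rewrite mul1r expr0 (le_trans (cnormB _ _)) //.
    by have := zn 0%N; have := zn 1%N; lra.
  have -> : z n.+2 - z n.+1 = z n.+1 * (z n.+1 - z n) + (z n.+1 - z n) * z n.
    rewrite [z n.+2]/= [in LHS](_ : z n.+1 = g * g + z n * z n) //.
    rewrite -[in LHS](_ : z n.+1 = g * g + z n * z n) //.
    by rewrite opprD addrACA subrr add0r mulrBr mulrBl addrA subrK.
  apply: le_trans (cnormD _ _) _.
  have := cnormM (z n.+1) (z n.+1 - z n).
  have := cnormM (z n.+1 - z n) (z n).
  have := zn n; have := zn n.+1.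
  have := cnorm_ge0 (z n.+1 - z n); have := cnorm_ge0 (z n).
  have := cnorm_ge0 (z n.+1); move: IH; rewrite !mul1r exprS.
  move: (cnorm (z n.+1 - z n)) (2^-1 ^+ n) => d e; nra.
have lE : l = g * g + l * l.
  apply: norm_cvg_uniq (norm_cvg_shift zl) _.
  by apply: norm_cvgD (norm_cvg_cst _) _; apply: norm_cvgM.
have ls : star l = l.
  apply: norm_cvg_uniq (norm_cvg_star zl) _.
  suff -> : (fun n => star (z n)) = z by [].
  apply/funext; elim=> [|n IH] /=; first exact: star0.
  by rewrite starD !starM gs IH.
have lg : l * g = g * l.
  apply: norm_cvg_uniq (norm_cvgMr g zl) _.
  suff -> : (fun n => z n * g) = (fun n => g * z n) by apply: norm_cvgMl.
  apply/funext; elim=> [|n IH] /=; first by rewrite mul0r mulr0.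
  by rewrite mulrDl mulrDr -(mulrA (z n)) IH !mulrA IH.
exists (1 - (l + l)); split.
- by rewrite starB star1 starD ls.
- by rewrite mulrBl mulrBr mul1r mulr1 mulrDl mulrDr lg.
rewrite mulrBl mul1r !mulrBr mulr1 !mulrDl !mulrDr.
have -> : g * g = l - l * l by rewrite {1}lE addrK.
rewrite !opprD !opprK; move: (l * l) (- l) => q p.
by rewrite -addrA (addrA (p + p)) (addrACA p q) (addrACA (p + p) (q + q)).
Qed.

(** For [g] self-adjoint with norm at most 1/4, [v = 2 g + i k] is an isometry, hence so is [f v],
    and [4 f(g) = f(v) + f(v)^*] has norm at most 2. Scaling gives the constant 2 on self-adjoint
    elements, and the C*-identity applied to [x^* x] extends the bound to all [x]. *)
Lemma star_hom_bounded A B (f : A -> B) : star_hom setT f -> bounded_hom f.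
Proof.
move=> [fD fZ fM fs f1].
have fN x : f (- x) = - f x by rewrite -scaleN1r fZ // scaleN1r.
have nu (v : B) : star v * v = 1 -> cnorm v = 1 by exact: cnorm_isometry.
have small (g : A) : star g = g -> cnorm g <= 4^-1 -> cnorm (f g) <= 2^-1.
  move=> gs gn; have [k [ks kg kk]] := selfadjoint_sqrt gs gn.
  pose v := g + g + 'i%C *: k.
  have vs : star v = g + g - 'i%C *: k.
    rewrite !starD starZ gs ks (_ : conjc 'i%C = - 'i%C) ?scaleNr //.
    by apply/eqP; rewrite eq_complex /= oppr0 !eqxx.
  have vv : star v * v = 1.
    rewrite vs mulrDr !mulrBl -!scalerAl -!scalerAr scalerA.
    have -> : k * (g + g) = (g + g) * k by rewrite mulrDr mulrDl kg.
    have -> : 'i%C * 'i%C = -1 :> R[i] by rewrite -expr2 sqr_i.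
    by rewrite scaleN1r opprK kk addrA subrK addrC subrK.
  have fv : cnorm (f v) = 1 by apply: nu; rewrite -fs // -fM // vv.
  have : cnorm (f v + star (f v)) <= 2.
    by rewrite (le_trans (cnormD _ _)) // cnorm_starE fv; lra.
  rewrite -fs // -fD // vs /v addrACA subrr addr0 fD // fD //.
  rewrite -!mulr2n -mulrnA -scaler_nat cnormZ.
  rewrite (_ : Normc.normc _ = 4); first by move: (cnorm _) => r; lra.
  rewrite -[X in Normc.normc X](rmorph_nat (real_complex R)).
  by rewrite normc_real normr_nat.
have sa (h : A) : star h = h -> cnorm (f h) <= 2 * cnorm h.
  move=> hs; have [->|h0] := eqVneq h 0.
    by rewrite -(scale0r 0) fZ // !scale0r !cnorm0 mulr0.
  have n0 : 0 < cnorm h.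
    rewrite lt_neqAle cnorm_ge0 andbT eq_sym.
    by apply: contraNneq h0 => /cnorm_eq0 ->.
  pose c : R := (4 * cnorm h)^-1.
  have c0 : 0 < c by rewrite invr_gt0 mulr_gt0.
  have := small (c%:C *: h).
  rewrite starZ conjc_real hs fZ // !cnormZ normc_real.
  rewrite gtr0_norm // => /(_ erefl) sm.
  have cn : c * cnorm h = 4^-1 by rewrite /c; field; rewrite gt_eqF.
  have /sm le2 : c * cnorm h <= 4^-1 by rewrite cn.
  by rewrite -(ler_pM2l c0) (mulrCA c) cn; apply: le_trans le2 _; lra.
split=> //.
- by move=> x y; apply: fD.
- by move=> a x; apply: fZ.
- by move=> x y; apply: fM.
- by move=> x; apply: fs.
exists 2 => x.
have := sa (star x * x); rewrite starM starK fM // fs // !cnorm_star.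
move=> /(_ erefl); have := cnorm_ge0 x; have := cnorm_ge0 (f x).
move: (cnorm x) (cnorm (f x)) => p q; nra.
Qed.

Lemma bounded_hom_comp A B C (S : B -> C) (T : A -> B) :
  bounded_hom S -> bounded_hom T -> bounded_hom (S \o T).
Proof.
move=> [SD SZ SM Ss [K SK]] [TD TZ TM Ts [L TL]]; split=> [x y|a x|x y|x|] /=.
- by rewrite TD SD.
- by rewrite TZ SZ.
- by rewrite TM SM.
- by rewrite Ts Ss.
have K0 : 0 <= K.
  by have := SK 1; rewrite cnorm1 mulr1; apply/le_trans/cnorm_ge0.
exists (K * L) => x; apply: le_trans (SK _) _; rewrite -mulrA.
exact: ler_wpM2l.
Qed.

End BoundedHom.

(** * The Cuntz algebra *)

(* Otherwise [apply] unfolds membership in a generated algebra to a product. *)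
Local Opaque cstar_gen.

Definition cuntz_pair (R : realType) (A : cstarAlgType R) (s1 s2 : A) : Prop :=
  [/\ Defs.isometry s1, Defs.isometry s2 & s1 * star s1 + s2 * star s2 = 1].

(** * Automorphisms of a subalgebra, up to equality on it *)

Section StarAut.
Variables (R : realType) (A : cstarAlgType R) (D : set A).
Hypotheses (DD : cstar_subalgebra D) (D1 : D 1).

Lemma star_aut_id : star_aut D (@id A).
Proof.
split; first by split.
by split=> // x Dx; exists x.
Qed.

Lemma star_aut_comp (f g : A -> A) :
  star_aut D f -> star_aut D g -> star_aut D (f \o g).
Proof.
move=> [[fD fZ fM fs f1] [ff fi fS]] [[gD gZ gM gs g1] [gf gi gS]].
split; split=> /=.
- by move=> x y Dx Dy; rewrite gD // fD //; apply: gf.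
- by move=> a x Dx; rewrite gZ // fZ //; apply: gf.
- by move=> x y Dx Dy; rewrite gM // fM //; apply: gf.
- by move=> x Dx; rewrite gs // fs //; apply: gf.
- by rewrite g1.
- by move=> x Dx; apply/ff/gf.
- move=> x y; rewrite !inE => Dx Dy /= /fi.
  rewrite !inE => /(_ (gf _ Dx) (gf _ Dy)) /gi; apply; exact: mem_set.
by move=> x /fS[y Dy <-]; have [z Dz <-] := gS _ Dy; exists z.
Qed.

Lemma star_aut_inv (f g : A -> A) :
  star_aut D f -> {in D, cancel f g} -> star_aut D g.
Proof.
move=> [[fD fZ fM fs f1] [ff fi fS]] fg.
have {}fg x : D x -> g (f x) = x by move=> Dx; apply/fg/mem_set.
have gf y : D y -> D (g y) /\ f (g y) = y.
  by move=> /fS[x Dx <-]; rewrite fg.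
split; split=> /=.
- move=> _ _ /fS[x Dx <-] /fS[y Dy <-]; rewrite -fD // !fg //.
  exact: subalgD.
- by move=> a _ /fS[x Dx <-]; rewrite -fZ // !fg //; apply: subalgZ.
- move=> _ _ /fS[x Dx <-] /fS[y Dy <-].
  by rewrite -fM // !fg //; apply: subalgM.
- by move=> _ /fS[x Dx <-]; rewrite -fs // !fg //; apply: subalg_star.
- by rewrite -{1}f1 fg.
- by move=> y /gf[].
- move=> x y; rewrite !inE => /gf[_ {2}<-] /gf[_ {2}<-] -> //.
by move=> x Dx; exists (f x); [apply: ff|rewrite fg].
Qed.

Lemma star_aut_ext (f g : A -> A) :
  star_aut D f -> {in D, f =1 g} -> star_aut D g.
Proof.
move=> [[fD fZ fM fs f1] [ff fi fS]] fg.
have {}fg x : D x -> g x = f x by move=> Dx; apply/esym/fg/mem_set.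
split; split=> /=.
- by move=> x y Dx Dy; rewrite !fg ?fD //; apply: subalgD.
- by move=> a x Dx; rewrite !fg ?fZ //; apply: subalgZ.
- by move=> x y Dx Dy; rewrite !fg ?fM //; apply: subalgM.
- by move=> x Dx; rewrite !fg ?fs //; apply: subalg_star.
- by rewrite fg.
- by move=> x Dx; rewrite fg //; apply: ff.
- move=> x y Dx Dy; rewrite !fg; [exact: fi|exact: set_mem|exact: set_mem].
by move=> x /fS[y Dy <-]; exists y => //; rewrite fg.
Qed.

Lemma star_aut_conj (f : A -> A) (w : A) : D w -> unitary w ->
  (forall x, D x -> f x = w * x * star w) -> star_aut D f.
Proof.
move=> Dw [ww' ww] fE.
have hf : star_aut D (fun x => w * x * star w).
  have [cD cZ cM cs _] := bounded_hom_conj ww'.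
  split; split=> //=.
  - by rewrite mulr1.
  - by move=> x Dx; apply: subalgM => //; [exact: subalgM|exact: subalg_star].
  - move=> x y _ _ /(congr1 (fun z => star w * z * w)).
    by rewrite !mulrA ww' !mul1r -!mulrA ww' !mulr1.
  move=> x Dx; exists (star w * x * w).
    by apply: subalgM => //; apply: subalgM => //; exact: subalg_star.
  by rewrite !mulrA ww mul1r -!mulrA ww mulr1.
by apply: star_aut_ext hf _ => x /set_mem Dx; rewrite fE.
Qed.

End StarAut.

Section Cuntz.
Variables (R : realType) (A : cstarAlgType R) (s1 s2 : A).
Hypothesis s12 : cuntz_pair s1 s2.
Implicit Types (b c : bool) (mu nu : seq bool) (x y w : A) (t : R[i]).

Local Notation "'s_ b" := (if b then s2 else s1) (at level 8, b at level 2).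
Local Notation S := (s_word s1 s2).
Local Notation O := (O2 s1 s2).
Local Notation D := (D2 s1 s2).

Lemma letter_isometry b : star 's_b * 's_b = 1.
Proof. by case: s12 => s1s s2s _; case: b. Qed.

Lemma letter_orthogonal : star s1 * s2 = 0.
Proof.
have [s1s s2s sum1] := s12.
have : star s1 * (s1 * star s1 + s2 * star s2) * s2 = star s1 * s2.
  by rewrite sum1 mulr1.
rewrite mulrDr mulrDl !mulrA s1s mul1r -!mulrA s2s mulr1 -[RHS]add0r.
exact: addIr.
Qed.

Lemma letter_star b c : star 's_b * 's_c = (b == c)%:R.
Proof.
have o := letter_orthogonal.
case: b c => -[]; rewrite ?(letter_isometry true) ?(letter_isometry false) //.
by rewrite -(starK s1) -starM o star0.
Qed.

Lemma letter_starM b c x : star 's_b * ('s_c * x) = (b == c)%:R * x.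
Proof. by rewrite mulrA letter_star. Qed.

Lemma s_word_nil : S [::] = 1.
Proof. by rewrite /s_word big_nil. Qed.

Lemma s_word_cons b mu : S (b :: mu) = 's_b * S mu.
Proof. by rewrite /s_word big_cons. Qed.

Lemma s_word_cat mu nu : S (mu ++ nu) = S mu * S nu.
Proof. by rewrite /s_word big_cat. Qed.

Lemma s_word_proj_cons b mu :
  S (b :: mu) * star (S (b :: mu)) = 's_b * (S mu * star (S mu)) * star 's_b.
Proof. by rewrite s_word_cons starM !mulrA. Qed.

(** Equal first letters reduce the claim to the tails; distinct first letters make both products
    vanish. *)
Lemma s_word_proj_comm mu nu :
  S mu * star (S mu) * (S nu * star (S nu)) =
  S nu * star (S nu) * (S mu * star (S mu)).
Proof.
elim: mu nu => [|b mu IH] [|c nu];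
  rewrite ?s_word_nil ?star1 ?mulr1 ?mul1r // !s_word_proj_cons.
rewrite -!mulrA !letter_starM eq_sym.
case: eqP => [->|_]; last by rewrite !mul0r !mulr0.
rewrite !mul1r; congr (_ * _); rewrite !mulrA; congr (_ * _).
by have := IH nu; rewrite !mulrA.
Qed.

Lemma D2_subalgebra : cstar_subalgebra D.
Proof. exact: cstar_gen_subalgebra. Qed.

Lemma O2_subalgebra : cstar_subalgebra O.
Proof. exact: cstar_gen_subalgebra. Qed.

Lemma D2_word mu : D (S mu * star (S mu)).
Proof. by apply: cstar_gen_incl; exists mu. Qed.

Lemma D2_1 : D 1.
Proof. by have := D2_word [::]; rewrite s_word_nil star1 mulr1. Qed.

Lemma D2_letter_proj b : D ('s_b * star 's_b).
Proof. by have := D2_word [:: b]; rewrite s_word_cons s_word_nil mulr1. Qed.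

Lemma D2_comm x y : D x -> D y -> x * y = y * x.
Proof.
apply: cstar_gen_commutative => {x y} [_ [mu ->]|_ _ [mu ->] [nu ->]].
  by rewrite starM starK.
exact: s_word_proj_comm.
Qed.

Lemma D2_letter_conj b x : D x -> D ('s_b * x * star 's_b).
Proof.
move=> Dx.
apply: (bounded_hom_gen (bounded_hom_conj (letter_isometry b)) D2_subalgebra
  _ Dx).
by move=> _ [mu ->]; rewrite -s_word_proj_cons; apply: D2_word.
Qed.

Lemma O2_letter b : O 's_b.
Proof. by apply: cstar_gen_incl; case: b; [right|left]. Qed.

Lemma O2_1 : O 1.
Proof.
have Os2 := O2_letter true; rewrite -(letter_isometry true).
exact (subalgM O2_subalgebra (subalg_star O2_subalgebra Os2) Os2).
Qed.

Lemma O2_word mu : O (S mu).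
Proof.
elim: mu => [|b mu IH]; first by rewrite s_word_nil; exact: O2_1.
rewrite s_word_cons; exact (subalgM O2_subalgebra (O2_letter b) IH).
Qed.

Lemma O2_D2 x : D x -> O x.
Proof.
apply: (cstar_gen_sub O2_subalgebra) => _ [mu ->].
exact (subalgM O2_subalgebra (O2_word mu)
  (subalg_star O2_subalgebra (O2_word mu))).
Qed.

(** * The dense *-algebra spanned by the monomials [s_mu s_nu^*] *)

Inductive cuntz_poly : A -> Prop :=
| poly_monomial mu nu : cuntz_poly (S mu * star (S nu))
| poly_zero : cuntz_poly 0
| poly_add x y : cuntz_poly x -> cuntz_poly y -> cuntz_poly (x + y)
| poly_scale t x : cuntz_poly x -> cuntz_poly (t *: x).

(** Common leading letters cancel until the letters differ or one of the words is exhausted. *)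
Lemma star_wordM mu nu :
  [\/ star (S mu) * S nu = 0, exists al, star (S mu) * S nu = S al
    | exists al, star (S mu) * S nu = star (S al)].
Proof.
elim: mu nu => [|b mu IH] nu.
  by apply: Or32; exists nu; rewrite s_word_nil star1 mul1r.
case: nu => [|c nu].
  by apply: Or33; exists (b :: mu); rewrite s_word_nil mulr1.
rewrite !s_word_cons starM -mulrA letter_starM.
by case: eqP => _; [rewrite mul1r|apply: Or31; rewrite mul0r mulr0].
Qed.

Lemma cuntz_poly_mul x y : cuntz_poly x -> cuntz_poly y -> cuntz_poly (x * y).
Proof.
move=> px; move: y; elim: px => {x} [mu nu| |x1 x2 _ p1 _ p2|t x _ px] y py.
- elim: py => {y} [al be| |y1 y2 _ p1 _ p2|t y _ py].
  + rewrite mulrA -(mulrA (S mu)).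
    case: (star_wordM nu al) => [->|[ga ->]|[ga ->]].
    * by rewrite mulr0 mul0r; exact: poly_zero.
    * by rewrite -s_word_cat; exact: poly_monomial.
    * by rewrite -mulrA -starM -s_word_cat; exact: poly_monomial.
  + by rewrite mulr0; exact: poly_zero.
  + by rewrite mulrDr; exact: poly_add.
  + by rewrite -scalerAr; exact: poly_scale.
- by rewrite mul0r; exact: poly_zero.
- by rewrite mulrDl; apply: poly_add; [exact: p1|exact: p2].
by rewrite -scalerAl; apply: poly_scale; exact: px.
Qed.

Lemma cuntz_poly_star x : cuntz_poly x -> cuntz_poly (star x).
Proof.
elim=> {x} [mu nu| |x1 x2 _ p1 _ p2|t x _ px].
- by rewrite starM starK; exact: poly_monomial.
- by rewrite star0; exact: poly_zero.
- by rewrite starD; exact: poly_add.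
by rewrite starZ; exact: poly_scale.
Qed.

(** The elements that polynomials approximate form a C*-subalgebra containing both generators. *)
Lemma cuntz_poly_dense x : O x ->
  forall e : R, 0 < e -> exists2 p, cuntz_poly p & cnorm (x - p) < e.
Proof.
move: x; apply: (cstar_gen_sub (B := [set x | forall e : R, 0 < e ->
  exists2 p, cuntz_poly p & cnorm (x - p) < e])).
  split=> /=.
  - split=> [e e0|x y hx hy e e0].
      by exists 0; [exact: poly_zero|rewrite subr0 cnorm0].
    have e20 : 0 < e / 2 by rewrite divr_gt0.
    have [p pp xp] := hx _ e20; have [q pq yq] := hy _ e20.
    exists (p + q); first exact: poly_add.
    by rewrite opprD addrACA (splitr e) (le_lt_trans (cnormD _ _)) // ltrD.
  - move=> t x hx e e0; have t1 : 0 < Normc.normc t + 1.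
      by rewrite ltr_wpDl // normc_ge0.
    have [p pp xp] := hx (e / (Normc.normc t + 1)) (divr_gt0 e0 t1).
    exists (t *: p); first exact: poly_scale.
    rewrite -scalerBr cnormZ; move: xp; rewrite ltr_pdivlMr //.
    by apply: le_lt_trans; rewrite mulrC ler_wpM2l ?cnorm_ge0 // lerDl.
  - move=> x y hx hy e e0; have e20 : 0 < e / 2 by rewrite divr_gt0.
    have y1 : 0 < cnorm y + 1 by rewrite ltr_wpDl // cnorm_ge0.
    (* [p] is chosen first, since the tolerance for [q] depends on [cnorm p]; adding 1 to the norms
       keeps the denominators positive. *)
    have [p pp xp] := hx _ (divr_gt0 e20 y1).
    have p1 : 0 < cnorm p + 1 by rewrite ltr_wpDl // cnorm_ge0.
    have [q pq yq] := hy _ (divr_gt0 e20 p1).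
    exists (p * q); first exact: cuntz_poly_mul.
    have -> : x * y - p * q = (x - p) * y + p * (y - q).
      by rewrite mulrBl mulrBr addrA subrK.
    rewrite (splitr e) (le_lt_trans (cnormD _ _)) // ltrD //.
      move: xp; rewrite ltr_pdivlMr //; apply: le_lt_trans.
      by rewrite (le_trans (cnormM _ _)) // ler_wpM2l ?cnorm_ge0 // lerDl.
    move: yq; rewrite ltr_pdivlMr //; apply: le_lt_trans.
    by rewrite mulrC (le_trans (cnormM _ _)) // ler_wpM2r ?cnorm_ge0 // lerDl.
  - move=> x hx e e0; have [p pp xp] := hx e e0.
    by exists (star p); [exact: cuntz_poly_star|rewrite -starB cnorm_starE].
  move=> x l hx xl e e0; have e20 : 0 < e / 2 by rewrite divr_gt0.
  have /cvgr0Pnorm_lt /(_ _ e20) [n _ /(_ n (leqnn n))] := xl.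
  rewrite ger0_norm ?cnorm_ge0 // => xnl.
  have [p pp xp] := hx n _ e20; exists p => //.
  rewrite (splitr e) (le_lt_trans (cnorm_dist_add (x n) _ _)) // ltrD //.
  by rewrite cnorm_distC.
have pl b : cuntz_poly 's_b.
  have := poly_monomial [:: b] [::].
  by rewrite s_word_cons s_word_nil star1 !mulr1.
move=> _ [->|->] e e0; [exists s1|exists s2]; rewrite ?subrr ?cnorm0 //.
  exact: (pl false).
exact: (pl true).
Qed.

(** * Compression of polynomials by high powers of the generators *)

Lemma star_word_exp c nu k :
  star (S nu) * 's_c ^+ (size nu + k) = (all (pred1 c) nu)%:R * 's_c ^+ k.
Proof.
elim: nu => [|b nu IH] /=; first by rewrite s_word_nil star1.
rewrite s_word_cons starM exprS -mulrA letter_starM.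
by case: eqP => _; rewrite ?mul1r ?IH // !mul0r mulr0.
Qed.

(* For large k, s_2^*^k s_mu is 0 or a positive power of s_2^*, and
   s_nu^* s_1^k is 0 or a positive power of s_1. *)
Lemma cuntz_poly_shift p : cuntz_poly p ->
  exists K, forall k, (K <= k)%N -> star (s2 ^+ k) * p * s1 ^+ k = 0.
Proof.
elim=> {p} [mu nu| |x y _ [K hK] _ [L hL]|t x _ [K hK]].
(* The extra 1 leaves at least one letter on each side after cancellation, so that [s2^* s1 = 0]
   applies in the middle. *)
- exists (size mu + size nu).+1 => k lek.
  have [i ik] : exists i, k = (size mu + i.+1)%N.
    by exists (k - size mu).-1; lia.
  have [j jk] : exists j, k = (size nu + j.+1)%N.
    by exists (k - size nu).-1; lia.
  rewrite mulrA -mulrA {2}jk (star_word_exp false nu) ik.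
  have := congr1 star (star_word_exp true mu i.+1).
  rewrite !starM starK => ->.
  rewrite star_bool; case: (all _ mu); last by rewrite mulr0 mul0r.
  rewrite mulr1; case: (all _ nu); last by rewrite mul0r mulr0.
  rewrite mul1r exprS starM exprS -mulrA (letter_starM true false).
  by rewrite mul0r mulr0.
- by exists 0%N => k _; rewrite mulr0 mul0r.
- exists (maxn K L) => k; rewrite geq_max => /andP[/hK xk /hL yk].
  by rewrite mulrDr mulrDl xk yk addr0.
by exists K => k /hK xk; rewrite -scalerAr -scalerAl xk scaler0.
Qed.

Lemma star_word_exp_letter nu k :
  star (S nu) * (s2 ^+ (size nu + k) * s1) =
  (all (pred1 true) nu)%:R * (s2 ^+ k * s1).
Proof. by rewrite mulrA (star_word_exp true) -mulrA. Qed.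

(** The words 2...21 form a prefix code: none of them begins another. *)
Lemma exp_letter_orthonormal i j :
  star (s2 ^+ i * s1) * (s2 ^+ j * s1) = (i == j)%:R.
Proof.
elim: i j => [|i IH] [|j].
- by rewrite expr0 mul1r (letter_star false false).
- by rewrite expr0 mul1r exprS -mulrA (letter_starM false true) mul0r.
- by rewrite expr0 mul1r exprS !starM -!mulrA (letter_star true false) !mulr0.
rewrite eqSS -IH ![s2 ^+ _.+1]exprS -!mulrA starM -mulrA.
by rewrite (letter_starM true true) mul1r.
Qed.

(** Once [k] exceeds the lengths of the words, a monomial survives only if both words are powers of
    [s2], and orthonormality of the [s2^i s1] makes the result a scalar that no longer depends on
    [k]. *)
Lemma cuntz_poly_compress p : cuntz_poly p ->
  exists K (a : R[i]), forall k, (K <= k)%N ->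
    star (s2 ^+ k * s1) * p * (s2 ^+ k * s1) = a *: 1.
Proof.
elim=> {p} [mu nu| |x y _ [K [a hK]] _ [L [c hL]]|t x _ [K [a hK]]].
- exists (size mu + size nu)%N.
  exists ((all (pred1 true) mu && all (pred1 true) nu) &&
    (size mu == size nu))%:R => k lek.
  have [i ik] : exists i, k = (size mu + i)%N by exists (k - size mu)%N; lia.
  have [j jk] : exists j, k = (size nu + j)%N by exists (k - size nu)%N; lia.
  rewrite (mulrA (star _)) -(mulrA _ (star (S nu))) {2}jk.
  rewrite star_word_exp_letter ik.
  have := congr1 star (star_word_exp_letter mu i).
  rewrite [LHS]starM starK => ->; rewrite starM star_bool.
  case: (all _ mu); last by rewrite mulr0 mul0r scale0r.
  case: (all _ nu); last by rewrite mul0r mulr0 scale0r.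
  rewrite mulr1 mul1r exp_letter_orthonormal scaler_nat.
  by have -> : (i == j) = (size mu == size nu) by lia.
- by exists 0%N, 0 => k _; rewrite mulr0 mul0r scale0r.
- exists (maxn K L), (a + c) => k; rewrite geq_max => /andP[/hK xk /hL yk].
  by rewrite mulrDr mulrDl xk yk scalerDl.
by exists K, (t * a) => k /hK xk; rewrite -scalerAr -scalerAl xk scalerA.
Qed.

(** The relation gives [w = t^K s2^*^K w s1^K]. The same compression kills a polynomial [p] at
    distance less than 1 from [w], so [w] would have norm less than 1. *)
Lemma no_flip w t : O w -> unitary w -> Normc.normc t = 1 ->
  s2 <> t *: (w * s1 * star w).
Proof.
move=> Ow [ww' ww] t1 s2E.
have h : s2 * w = t *: (w * s1) by rewrite {1}s2E -scalerAl -!mulrA ww' mulr1.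
have [p pp wp] := cuntz_poly_dense Ow ltr01.
have [K /(_ K (leqnn K)) pK] := cuntz_poly_shift pp.
have e1 : t ^+ K *: (star (s2 ^+ K) * w * s1 ^+ K) = w.
  rewrite -mulrA scalerAr -(intertwineX K h) mulrA.
  by rewrite (isometryX K (letter_isometry true)) mul1r.
have e2 : star (s2 ^+ K) * w * s1 ^+ K = star (s2 ^+ K) * (w - p) * s1 ^+ K.
  by rewrite mulrBr mulrBl pK subr0.
have := cnorm_isometry_compress (w - p) (isometryX K (letter_isometry true))
  (isometryX K (letter_isometry false)).
have := cnorm_isometry ww'; rewrite -{1}e1 cnormZ (normcX _ t1) mul1r e2 => ->.
by move=> /(lt_le_trans wp); rewrite ltxx.
Qed.

(** Since [w] commutes with [s1 s1^*], its corner [b = s1^* w s1] is unitary. Since [s2 w = t w s2],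
    also [b = t^k (s2^k s1)^* w (s2^k s1)] for every [k], which compression of polynomials shows to
    be close to a scalar. *)
Lemma corner_central w t : O w -> unitary w -> Normc.normc t = 1 ->
  s2 = t *: (w * s2 * star w) -> w * (s1 * star s1) = s1 * star s1 * w ->
  t *: (w * s1 * star w) * s1 = s1 * s1.
Proof.
move=> Ow [ww' ww] t1 s2E wq.
have h : s2 * w = t *: (w * s2) by rewrite {1}s2E -scalerAl -!mulrA ww' mulr1.
have s11 := letter_isometry false; have s22 := letter_isometry true.
pose b := star s1 * w * s1.
have ws1 : w * s1 = s1 * b.
  by rewrite /b !mulrA -wq -!mulrA s11 mulr1.
have w's1 : star w * s1 = s1 * star b.
  have := congr1 star wq; rewrite !starM starK => wq'.
  by rewrite !mulrA wq' -!mulrA s11 mulr1.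
have bb : star b * b = 1.
  rewrite /b !starM starK -!mulrA (mulrA s1) (mulrA _ w) -wq.
  by rewrite -mulrA (mulrA (star w)) ww' mul1r -mulrA s11 mulr1 s11.
have bb' : b * star b = 1.
  by rewrite {1}/b -!mulrA -w's1 (mulrA w) ww mul1r s11.
have nb : cnorm b = 1 by exact: cnorm_isometry.
have approx (e : R) : 0 < e -> exists K (a : R[i]), forall k, (K <= k)%N ->
    cnorm (b - (t ^+ k * a) *: 1) < e.
  move=> e0; have [p pp wp] := cuntz_poly_dense Ow e0.
  have [K [a hK]] := cuntz_poly_compress pp; exists K, a => k /hK pk.
  have <- : t ^+ k *: (star (s2 ^+ k * s1) * w * (s2 ^+ k * s1)) = b.
    rewrite -mulrA (mulrA w) scalerAr scalerAl -(intertwineX k h) starM.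
    by rewrite -!mulrA (mulrA (star (s2 ^+ k))) (isometryX k s22) mul1r mulrA.
  rewrite -scalerA -pk -scalerBr cnormZ (normcX _ t1) mul1r -mulrBl -mulrBr.
  apply: le_lt_trans wp; apply: cnorm_isometry_compress;
  exact: isometryM (isometryX k s22) s11.
(* A limit of scalars commutes with everything. *)
have bs1 : b * s1 = s1 * b.
  apply/eqP; rewrite -subr_eq0; apply/eqP/cnorm_eq0/le_anti.
  rewrite cnorm_ge0 andbT; apply/ler_addgt0Pr => e e0; rewrite add0r.
  have e20 : 0 < e / 2 by rewrite divr_gt0.
  have [K [a /(_ K (leqnn K))]] := approx _ e20; set c := t ^+ K * a => bc.
  have -> : b * s1 - s1 * b = (b - c *: 1) * s1 - s1 * (b - c *: 1).
    rewrite mulrBl mulrBr -scalerAl -scalerAr mul1r mulr1 opprB.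
    by rewrite [RHS]addrA subrK.
  rewrite (splitr e) ltW // (le_lt_trans (cnormB _ _)) // ltrD //.
    apply: le_lt_trans (cnormM _ _) _; by rewrite (cnorm_isometry s11) mulr1.
  by rewrite (cnorm_isometryM _ s11).
(* The scalar [a] serves both [K] and [K.+1]: [b] is close to [t^K a] and to [t^(K+1) a], hence
   [t b] is close to [b]. *)
have t_1 : t = 1.
  apply/eqP; rewrite -subr_eq0; apply/eqP/Normc.eq0_normc/le_anti.
  rewrite normc_ge0 andbT; apply/ler_addgt0Pr => e e0; rewrite add0r.
  have e20 : 0 < e / 2 by rewrite divr_gt0.
  have [K [a hK]] := approx _ e20.
  have b1 := hK K (leqnn K); have b2 := hK K.+1 (leqnSn K).
  rewrite -[Normc.normc _]mulr1 -nb -cnormZ.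
  have -> : (t - 1) *: b =
      t *: (b - (t ^+ K * a) *: 1) - (b - (t ^+ K.+1 * a) *: 1).
    by rewrite scalerBr scalerA mulrA -exprS opprB addrA subrK scalerBl scale1r.
  rewrite (splitr e) ltW // (le_lt_trans (cnormB _ _)) // ltrD //.
  by rewrite cnormZ t1 mul1r.
(* [w s1 w^* s1 = s1 b s1 b^* = s1 s1 b b^* = s1 s1]. *)
rewrite t_1 scale1r -(mulrA (w * s1)) w's1 ws1 -(mulrA s1 b) (mulrA b s1).
by rewrite bs1 -(mulrA s1 b) bb' mulr1.
Qed.

(** * Automorphisms that are gauge and flip-flop up to inner ones *)

Definition twisted_conj (f : A -> A) : Prop :=
  star_aut O f /\ exists w t e, [/\ O w, unitary w, Normc.normc t = 1
    & forall b, f 's_b = t *: (w * 's_(b (+) e) * star w)].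

Lemma star_hom_unitary (f : A -> A) w : star_hom O f -> O w -> unitary w ->
  unitary (f w).
Proof.
move=> [_ _ fM fs f1] Ow [ww' ww]; have Osw := subalg_star O2_subalgebra Ow.
by split; rewrite -fs // -fM // ?ww' ?ww.
Qed.

Lemma star_hom_twist (f : A -> A) w t x : star_hom O f -> O w -> O x ->
  f (t *: (w * x * star w)) = t *: (f w * f x * star (f w)).
Proof.
move=> [_ fZ fM fs _] Ow Ox; have Osw := subalg_star O2_subalgebra Ow.
have Owx := subalgM O2_subalgebra Ow Ox.
by rewrite fZ ?fM ?fs //; exact (subalgM O2_subalgebra Owx Osw).
Qed.

Lemma flip_gauge_inner_twisted (f : A -> A) :
  flip_gauge_inner s1 s2 f -> twisted_conj f.
Proof.
case=> [[fA f1 f2]|[t t1 [fA f1 f2]]|[w [Ow uw fE]]].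
- split=> //; exists 1, 1, true.
  split; [exact: O2_1|exact: unitary1|exact: Normc.normc1|].
  by case; rewrite /= star1 mulr1 mul1r scale1r.
- split=> //; exists 1, t, false.
  split; [exact: O2_1|exact: unitary1| |].
    by move: t1; rewrite normc_def => /(congr1 (@complex.Re R)); case: (t).
  by case; rewrite /= star1 mulr1 mul1r.
split; first exact (star_aut_conj O2_subalgebra O2_1 Ow uw fE).
exists w, 1, false; split=> //; first exact: Normc.normc1.
by move=> b; rewrite addbF scale1r fE //; exact (O2_letter b).
Qed.

Lemma twisted_conj_comp (f g : A -> A) :
  twisted_conj f -> twisted_conj g -> twisted_conj (f \o g).
Proof.
move=> [fA [w [t [e [Ow uw t1 fs]]]]] [gA [w' [t' [e' [Ow' uw' t1' gs]]]]].
split; first exact: star_aut_comp fA gA.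
(* Applying [f] to the formula for [g] conjugates by [f w'] what [f] has already conjugated by
   [w]. *)
have [fh [ff _ _]] := fA; exists (f w' * w), (t' * t), (e' (+) e); split.
- exact (subalgM O2_subalgebra (ff _ Ow') Ow).
- by apply: unitaryM => //; exact: star_hom_unitary.
- by rewrite Normc.normcM t1 t1' mulr1.
move=> b; rewrite /= gs star_hom_twist //; last exact (O2_letter _).
by rewrite fs addbA -scalerAr -scalerAl scalerA starM !mulrA.
Qed.

Lemma twisted_conj_inv (f g : A -> A) :
  twisted_conj f -> {in O, cancel f g} -> twisted_conj g.
Proof.
move=> [fA [w [t [e [Ow uw t1 fs]]]]] fg.
have gA := star_aut_inv O2_subalgebra O2_1 fA fg.
have [gh [gf _ _]] := gA; have ugw := star_hom_unitary gh Ow uw.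
split=> //; exists (star (g w)), t^-1, e; split.
- exact (subalg_star O2_subalgebra (gf _ Ow)).
- exact: unitary_star.
- by rewrite Normc.normcV t1 invr1.
(* Applying [g] to the formula for [f] on the letter [b (+) e] yields an equation in which [g] of
   the letter [b] is conjugated by [g w]; it is then solved for that value. *)
move=> b; have {1}-> : b = (b (+) e) (+) e by rewrite -addbA addbb addbF.
set c := b (+) e.
have <- : g (f 's_c) = 's_c by apply: fg; apply: mem_set; exact (O2_letter c).
rewrite fs star_hom_twist //; last exact (O2_letter _).
have t0 : t != 0.
  apply/eqP => t0; move: t1; rewrite t0 Normc.normc0 => /eqP.
  by rewrite eq_sym oner_eq0.
rewrite -scalerAr -scalerAl scalerA mulVf // scale1r starK.
case: ugw => gw' gw.
by rewrite !mulrA gw' mul1r -!mulrA gw' mulr1.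
Qed.

(** The form [Ad w o alpha_t o sigma^e] on the letters is preserved by every constructor; flips
    cancel in pairs, which is why [e] is a boolean combined by exclusive or. *)
Lemma generated_twisted (f : A -> A) :
  generated_subgroup O (flip_gauge_inner s1 s2) f -> twisted_conj f.
Proof.
elim=> {f} [f||f g _ hf _ hg|f g _ hf fg|f g _ [fA fE] fg].
- exact: flip_gauge_inner_twisted.
- split; first exact: star_aut_id.
  exists 1, 1, false.
  split; [exact: O2_1|exact: unitary1|exact: Normc.normc1|].
  by move=> b; rewrite addbF star1 mulr1 mul1r scale1r.
- exact: twisted_conj_comp.
- exact: twisted_conj_inv fg.
split; first exact (star_aut_ext O2_subalgebra O2_1 fA fg).
case: fE => w [t [e [Ow uw t1 fs]]]; exists w, t, e; split=> // b.
by rewrite -fs; apply/esym/fg/mem_set; exact (O2_letter b).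
Qed.

(** The obstruction to membership in the subgroup. Fixing [s2] excludes the flip; fixing [s1 s1^*],
    where [t] cancels against its conjugate, makes [w] commute with this projection. *)
Lemma generated_corner (f : A -> A) :
  generated_subgroup O (flip_gauge_inner s1 s2) f -> f s2 = s2 ->
  f (s1 * star s1) = s1 * star s1 -> f s1 * s1 = s1 * s1.
Proof.
move=> /generated_twisted[[[_ _ fM fs _] _] [w [t [e [Ow uw t1 fE]]]]] f2 fq.
have := fE true; rewrite f2; case: e fE => fE s2E.
  by case: (no_flip Ow uw t1 s2E).
have Os1 := O2_letter false.
rewrite (fE false); apply: corner_central => //.
have tt := normc_conj_mul t1; case: uw => ww' ww.
move: fq; rewrite fM // ?fs //; last exact (subalg_star O2_subalgebra Os1).
rewrite (fE false) starZ -scalerAr -scalerAl scalerA mulrC tt scale1r.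
rewrite !starM starK -!mulrA (mulrA (star w)) ww' mul1r.
move=> /(congr1 (fun x => x * w)).
by rewrite -!mulrA ww' mulr1.
Qed.

End Cuntz.

(** * Exponentials of symmetries *)

Section Rotation.
Variables (R : realType).
Implicit Types (th : R).

Lemma sin_le_id th : 0 <= th -> `|sin th| <= th.
Proof.
move=> th0; have [|c _] := @MVT_segment R sin cos 0 th th0.
  by apply: continuous_subspaceT => x; exact: continuous_sin.
rewrite sin0 !subr0 => ->; rewrite normrM (ger0_norm th0).
by rewrite -[leRHS]mul1r ler_wpM2r // cos_max.
Qed.

Lemma cos_sub1_le th : 0 <= th -> `|cos th - 1| <= th.
Proof.
move=> th0; have h0 : 0 <= th / 2 by rewrite divr_ge0.
have -> : cos th - 1 = - (sin (th / 2) ^+ 2 *+ 2).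
  have -> : cos th = cos ((th / 2) *+ 2) by rewrite -mulr_natr divfK.
  by rewrite cos_mulr2n cos2sin2; ring.
rewrite normrN ger0_norm ?mulrn_wge0 ?sqr_ge0 //.
have := sin_le_id h0; have := sin_max (th / 2).
rewrite -[sin _ ^+ 2]ger0_norm ?sqr_ge0 // normrX.
have := normr_ge0 (sin (th / 2)); move: (`|sin _|) => y y0 y1 yth.
have : y ^+ 2 <= y by rewrite expr2 ler_piMr.
by rewrite mulr2n; lra.
Qed.

Variable A : cstarAlgType R.
Implicit Types (x e : A).

Definition phase th : R[i] := (cos th +i* sin th)%C.

(** For [e^2 = 1] this is [exp(i th e)], in closed form. *)
Definition rotation th e : A := (cos th)%:C *: 1 + ('i%C * (sin th)%:C) *: e.

Lemma phaseE th : phase th = (cos th)%:C + 'i%C * (sin th)%:C.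
Proof.
by apply/eqP; rewrite eq_complex /=; apply/andP; split; apply/eqP; ring.
Qed.

Lemma phaseD th1 th2 : phase (th1 + th2) = phase th1 * phase th2.
Proof.
apply/eqP; rewrite eq_complex /= cosD sinD; apply/andP; split=> //.
by apply/eqP; ring.
Qed.

Lemma star_rotation th e :
  star e = e -> star (rotation th e) = rotation (- th) e.
Proof.
move=> es; rewrite /rotation starD !starZ star1 es cosN sinN conjc_real.
congr (_ + _ *: _); apply/eqP; rewrite eq_complex /=.
by apply/andP; split; apply/eqP; ring.
Qed.

Lemma rotationM th1 th2 e : e * e = 1 ->
  rotation th1 e * rotation th2 e = rotation (th1 + th2) e.
Proof.
move=> ee; rewrite /rotation mulrDl !mulrDr -!scalerAl -!scalerAr.
rewrite !mul1r mulr1 ee !scalerA [X in _ + X]addrC addrACA -!scalerDl.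
rewrite cosD sinD; congr (_ *: _ + _ *: _); apply/eqP; rewrite eq_complex /=;
by apply/andP; split; apply/eqP; ring.
Qed.

Lemma rotation0 e : rotation 0 e = 1.
Proof. by rewrite /rotation cos0 sin0 mulr0 scale0r addr0 scale1r. Qed.

Lemma unitary_rotation th e : star e = e -> e * e = 1 ->
  unitary (rotation th e).
Proof.
move=> es ee; split; rewrite (star_rotation _ es) rotationM //.
  by rewrite addNr rotation0.
by rewrite subrr rotation0.
Qed.

Lemma rotation_sub1 th e : 0 <= th -> cnorm e <= 1 ->
  cnorm (rotation th e - 1) <= 2 * th.
Proof.
move=> th0 e1; have -> : rotation th e - 1 =
    (cos th - 1)%:C *: 1 + ('i%C * (sin th)%:C) *: e.
  by rewrite rmorphB scalerBl scale1r /rotation addrAC.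
rewrite (le_trans (cnormD _ _)) // !cnormZ cnorm1 mulr1.
rewrite Normc.normcM !normc_real.
have -> : Normc.normc 'i%C = 1 :> R.
  by rewrite /Normc.normc /= expr0n /= add0r expr1n sqrtr1.
rewrite mul1r; have := sin_le_id th0; have := cos_sub1_le th0.
have := normr_ge0 (sin th); have := cnorm_ge0 e.
move: `|sin th| `|cos th - 1| (cnorm e) e1 => p q r; nra.
Qed.

Lemma rotation_eigen th e x : e * x = x -> rotation th e * x = phase th *: x.
Proof.
by move=> ex; rewrite mulrDl -!scalerAl mul1r ex -scalerDl phaseE.
Qed.

Lemma rotation_eigenN th e x : e * x = - x ->
  rotation th e * x = phase (- th) *: x.
Proof.
move=> ex; rewrite mulrDl -!scalerAl mul1r ex phaseE cosN sinN.
by rewrite rmorphN mulrN scalerDl scaleNr scalerN.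
Qed.

Lemma rotation_intertwine th (a b v : A) : a * v = v * b ->
  rotation th a * v = v * rotation th b.
Proof.
by move=> h; rewrite mulrDl mulrDr -!scalerAl -!scalerAr h mul1r mulr1.
Qed.

End Rotation.

(** * The 2-adic ring C*-algebra *)

Section TwoAdic.
Variables (R : realType) (A : cstarAlgType R) (u s2 : A).
Hypothesis rel : Q2_relations u s2.
Implicit Types (a f x y : A) (k m n : nat).

Local Notation s1 := (u * s2).
Local Notation D := (D2 s1 s2).
Local Notation O := (O2 s1 s2).

Let uu' : star u * u = 1. Proof. by case: rel => -[]. Qed.
Let uu : u * star u = 1. Proof. by case: rel => -[]. Qed.
Let s22 : star s2 * s2 = 1. Proof. by case: rel. Qed.

Lemma Q2_cuntz_pair : cuntz_pair s1 s2.
Proof.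
case: rel => _ _ _ sum1; split=> //; first exact: isometryM.
by rewrite addrC starM !mulrA.
Qed.

Let s12 := Q2_cuntz_pair.

(** * Translation and dilation on the diagonal *)

Lemma shift_s1 : u * s1 = s2 * u.
Proof. by case: rel => _ _ -> _; rewrite mulrA. Qed.

Lemma unshift_s2 : star u * s2 = s1 * star u.
Proof.
by rewrite -[LHS]mulr1 -uu !mulrA -(mulrA _ s2) -shift_s1 !mulrA uu' mul1r.
Qed.

Lemma unshift_s1 : star u * s1 = s2.
Proof. by rewrite mulrA uu' mul1r. Qed.

(** [u] is the odometer: a leading 2 becomes 1, and a leading 1 becomes 2 with the carry passed to
    the tail, whence the induction on the word. *)
Lemma D2_shift x : D x -> D (u * x * star u).
Proof.
move=> Dx; apply: (bounded_hom_gen (bounded_hom_conj uu') (D2_subalgebra _ _)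
  _ Dx) => _ [mu ->].
elim: mu => [|b mu IH].
  by rewrite s_word_nil star1 mulr1 mulr1 uu; exact: D2_1.
rewrite s_word_proj_cons conj_mul; case: b.
  exact (D2_letter_conj s12 false (D2_word _)).
by rewrite shift_s1 -conj_mul; exact (D2_letter_conj s12 true IH).
Qed.

Lemma D2_unshift x : D x -> D (star u * x * u).
Proof.
have := bounded_hom_conj (unitary_star (conj uu' uu)).1; rewrite starK => hu Dx.
apply: (bounded_hom_gen hu (D2_subalgebra _ _) _ Dx) => _ [mu ->].
elim: mu => [|b mu IH].
  by rewrite s_word_nil star1 mulr1 mulr1 uu'; exact: D2_1.
have unshift_conj y v :
    star u * (y * v * star y) * u = star u * y * v * star (star u * y).
  by rewrite starM starK !mulrA.
rewrite s_word_proj_cons unshift_conj; case: b; last first.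
  by rewrite unshift_s1; exact (D2_letter_conj s12 true (D2_word _)).
rewrite unshift_s2 -conj_mul starK; exact (D2_letter_conj s12 false IH).
Qed.

(* On D_2 = C(Z_2), where u acts by translation by 1, this is the map
   a |-> a o ceil(. / 2), a right inverse up to a factor 2 of
   a |-> a(2 x) + a(2 x - 1). *)
Definition dilate a : A :=
  s2 * a * star s2 + star u * (s2 * a * star s2) * u.

(** The isometry of [x |-> 2 x - 1]. Its range is complementary to that of [s2], and [dilate] is the
    endomorphism induced by this second pair. *)
Let r := star u * s2.

Lemma dilateE a : dilate a = s2 * a * star s2 + r * a * star r.
Proof. by rewrite /dilate /r starM starK !mulrA. Qed.

Let rr : star r * r = 1.
Proof. by rewrite /r starM starK !mulrA -(mulrA _ u) uu mulr1 s22. Qed.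

Let rs2 : star r * s2 = 0.
Proof.
by rewrite /r starM starK -mulrA (letter_star s12 true false).
Qed.

Let s2r : star s2 * r = 0.
Proof. by rewrite -(starK r) -starM rs2 star0. Qed.

Lemma dilate_s2 a : dilate a * s2 = s2 * a.
Proof.
by rewrite dilateE mulrDl -!mulrA rs2 s22 !mulr0 addr0 mulr1.
Qed.

(** On functions, [ceil((2 x - 1) / 2) = x]: both values entering the functional equation are
    [a(x)]. *)
Lemma shift_dilate_s2 a : u * dilate a * star u * s2 = s2 * a.
Proof.
rewrite -(mulrA (u * _)) -/r -mulrA dilateE mulrDl -!mulrA s2r rr.
by rewrite !mulr0 add0r mulr1 /r !mulrA uu mul1r.
Qed.

(** On functions, [ceil((2 x + 1) / 2) = x + 1]. *)
Lemma dilate_s1 a : dilate a * s1 = s1 * (star u * a * u).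
Proof.
rewrite dilateE mulrDl -!mulrA (letter_star s12 true false) !mulr0 add0r.
rewrite /r starM starK -(mulrA _ u) (mulrA u u) -expr2.
case: rel => _ _ <- _; rewrite (mulrA (star s2)) s22 mul1r.
by rewrite mulrA unshift_s2 !mulrA.
Qed.

Lemma dilate1 : dilate 1 = 1.
Proof.
case: rel => _ _ _ sum1.
have -> : dilate 1 = star u * (u * s2 * star s2 * star u + s2 * star s2) * u.
  rewrite /dilate !mulr1 mulrDr mulrDl !mulrA uu' mul1r -(mulrA _ (star u)).
  by rewrite uu' mulr1.
by rewrite addrC sum1 mulr1 uu'.
Qed.

Lemma dilateM x y : dilate x * dilate y = dilate (x * y).
Proof.
rewrite !dilateE mulrDl !mulrDr.
have h (p q p' q' : A) : p * x * star q * (q' * y * star p') =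
    p * x * (star q * q') * y * star p' by rewrite !mulrA.
by rewrite !h s22 s2r rs2 rr !mulr0 !mul0r addr0 add0r !mulr1 !mulrA.
Qed.

Lemma star_dilate a : star (dilate a) = dilate (star a).
Proof. by rewrite !dilateE starD !starM !starK !mulrA. Qed.

Lemma D2_dilate a : D a -> D (dilate a).
Proof.
move=> Da; have Dsa := D2_letter_conj s12 true Da.
exact (subalgD (D2_subalgebra _ _) Dsa (D2_unshift Dsa)).
Qed.

(* The function x |-> (-1)^ceil(x / 2^k) on Z_2. *)
Definition parity k : A := iter k dilate (s2 * star s2 - s1 * star s1).

Lemma star_parity k : star (parity k) = parity k.
Proof.
elim: k => [|k IH]; first by rewrite /parity /= starB !starM !starK.
by rewrite /parity /= star_dilate; congr dilate.
Qed.

Lemma parity_sqr k : parity k * parity k = 1.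
Proof.
elim: k => [|k IH]; last by rewrite /parity /= dilateM -dilate1; congr dilate.
have [s11 _ sum1] := s12.
rewrite /parity /= mulrBl !mulrBr.
have h (p q q' p' : A) :
    p * star q * (q' * star p') = p * (star q * q') * star p'.
  by rewrite !mulrA.
rewrite !h s22 s11 (letter_star s12 true false) (letter_star s12 false true).
by rewrite !mulr0 !mul0r !mulr1 subr0 sub0r opprK addrC.
Qed.

Lemma D2_parity k : D (parity k).
Proof.
elim: k => [|k IH]; last exact: D2_dilate.
exact (subalgB (D2_subalgebra _ _) (D2_letter_proj true)
  (D2_letter_proj false)).
Qed.

Lemma parity_s2 k : parity k.+1 * s2 = s2 * parity k.
Proof. exact: dilate_s2. Qed.

Lemma parity0_s2 : parity 0 * s2 = s2.
Proof.
rewrite /parity /= mulrBl -!mulrA s22 (letter_star s12 false true) !mulr0.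
by rewrite subr0 mulr1.
Qed.

Lemma parity0_s1 : parity 0 * s1 = - s1.
Proof.
have [s11 _ _] := s12.
rewrite /parity /= mulrBl -!(mulrA _ (star _)) s11.
by rewrite (letter_star s12 true false) mulr0 sub0r mulr1.
Qed.

Lemma unshift_mul_s1 a : star u * a * u * s1 = star u * (a * s2) * u.
Proof. by rewrite -(mulrA _ u) shift_s1 !mulrA. Qed.

Lemma unshift_mul_s2 a : star u * a * u * s2 = star u * (a * s1).
Proof. by rewrite !mulrA. Qed.

Lemma parity1_s1s1 : parity 1 * (s1 * s1) = s1 * s1.
Proof.
rewrite mulrA [parity 1]/(dilate (parity 0)) dilate_s1 -(mulrA s1).
rewrite unshift_mul_s1 parity0_s2 -(mulrA (star u) s2) -shift_s1.
by rewrite (mulrA (star u)) uu' mul1r.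
Qed.

(** [s1 s1] is [x |-> 4 x + 3], and [ceil((4 x + 3) / 4) = x + 1]. *)
Lemma parity_s1s1 k :
  parity k.+2 * (s1 * s1) = s1 * s1 * (star u * parity k * u).
Proof.
rewrite mulrA [parity k.+2]/(dilate (parity k.+1)) dilate_s1 -(mulrA s1).
by rewrite unshift_mul_s1 parity_s2 (mulrA (star u) s2) unshift_s2 !mulrA.
Qed.

(** For [x = 2^m y], [ceil((x + 1) / 2^k) = 2^(m-k) y + 1] is odd. *)
Lemma unshift_parity_exp k m : (k < m)%N ->
  star u * parity k * u * s2 ^+ m = - s2 ^+ m.
Proof.
elim: k m => [|k IH] [|m] //.
  move=> _; rewrite exprS mulrA unshift_mul_s2 parity0_s1 mulrN.
  by rewrite unshift_s1 mulNr.
rewrite ltnS => /IH km; rewrite exprS mulrA unshift_mul_s2.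
rewrite [parity k.+1]/(dilate (parity k)) dilate_s1 (mulrA (star u) s1).
by rewrite unshift_s1 -(mulrA s2) km mulrN.
Qed.

(** * The solution of the functional equation as an infinite product *)

Definition factor k : A := rotation (pi / 2 ^+ k) (parity k).

Fixpoint partial_twist n : A :=
  if n is n'.+1 then partial_twist n' * factor n' else 1.

Lemma D2_factor k : D (factor k).
Proof.
have DD := D2_subalgebra s1 s2.
exact (subalgD DD (subalgZ DD _ (@D2_1 R A s1 s2))
  (subalgZ DD _ (D2_parity k))).
Qed.

Lemma D2_partial_twist n : D (partial_twist n).
Proof.
elim: n => [|n IH]; first exact: D2_1.
exact (subalgM (D2_subalgebra _ _) IH (D2_factor n)).
Qed.

Lemma unitary_partial_twist n : unitary (partial_twist n).
Proof.
elim: n => [|n IH]; first exact: unitary1.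
apply: unitaryM => //; apply: unitary_rotation; first exact: star_parity.
exact: parity_sqr.
Qed.

(** The [n]-th factor is within [2 pi / 2^n] of 1. The rate is recorded because the limit is later
    compared with partial products on shrinking sets. *)
Lemma partial_twist_cvg : exists f, norm_cvg cnorm partial_twist f /\
  exists K : R, forall n, cnorm (partial_twist n - f) <= K * 2^-1 ^+ n.
Proof.
have [|f [fl fn]] := @norm_cvg_geometric _ _ partial_twist (2 * pi).
  move=> n; rewrite /= -[X in _ - X]mulr1 -mulrBr.
  rewrite (cnorm_isometryM _ (unitary_partial_twist n).1).
  have := @rotation_sub1 R A (pi / 2 ^+ n) (parity n).
  rewrite exprVn mulrA; apply; last first.
    by rewrite cnorm_isometry // /Defs.isometry star_parity parity_sqr.
  by rewrite divr_ge0 ?pi_ge0 ?exprn_ge0.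
by exists f; split=> //; exists (2 * (2 * pi)).
Qed.

(** Both parities of index [k.+1] restrict to [parity k], so the two angles [pi / 2^(k+1)] add up to
    [pi / 2^k]. *)
Lemma factor_s2 k :
  factor k.+1 * (u * factor k.+1 * star u) * s2 = s2 * factor k.
Proof.
pose th : R := pi / 2 ^+ k.+1.
have e1 : factor k.+1 * s2 = s2 * rotation th (parity k).
  by apply: rotation_intertwine; exact: parity_s2.
have e2 : u * factor k.+1 * star u * s2 = s2 * rotation th (parity k).
  have -> : u * factor k.+1 * star u = rotation th (u * parity k.+1 * star u).
    by rewrite /factor /rotation mulrDr mulrDl -!scalerAr -!scalerAl mulr1 uu.
  by apply: rotation_intertwine; exact: shift_dilate_s2.
rewrite -mulrA e2 mulrA e1 -mulrA rotationM ?parity_sqr // /factor /th.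
by congr (_ * rotation _ _); rewrite exprS; field; rewrite expf_neq0.
Qed.

(** The product telescopes: the two copies of factor [k.+1] merge into factor [k], and the two
    copies of factor 0 cancel. *)
Lemma partial_twist_s2 n :
  partial_twist n.+1 * (u * partial_twist n.+1 * star u) * s2 =
  s2 * partial_twist n.
Proof.
elim: n => [|n IH].
  (* Angle [pi] gives the scalar -1 whatever the parity. *)
  have -> : partial_twist 1 = -1.
    rewrite /= mul1r /factor expr0 divr1 /rotation cospi sinpi mulr0 scale0r.
    by rewrite addr0 rmorphN scaleN1r.
  by rewrite mulN1r mulrN1 !mulNr opprK uu mul1r mulr1.
rewrite [partial_twist n.+2]/= [partial_twist n.+1 in RHS]/=.
set p := partial_twist n.+1 in IH *; set g := factor n.+1.
have -> : u * (p * g) * star u = u * p * star u * (u * g * star u).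
  by rewrite !mulrA -(mulrA _ (star u) u) uu' mulr1.
have gp : g * (u * p * star u) = u * p * star u * g.
  apply: (D2_comm s12); first exact: D2_factor.
  exact (D2_shift (D2_partial_twist n.+1)).
rewrite -(mulrA p) (mulrA g) gp -(mulrA _ g) (mulrA p) -(mulrA _ _ s2).
by rewrite factor_s2 mulrA IH mulrA.
Qed.

(** On [3 + 4 * 2^k Z_2] the parities are -, +, -, -, ..., so the angles sum to [- pi + pi/2 - pi/4
    - ... - pi/2^(k+1) = - pi + pi/2^(k+1)]. *)
Lemma partial_twist_eigen k :
  partial_twist k.+2 * (s1 * s1 * s2 ^+ k) =
  - phase (pi / 2 ^+ k.+1) *: (s1 * s1 * s2 ^+ k).
Proof.
have phasepi (th : R) : phase (- pi + th) = - phase th.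
  rewrite phaseD -[RHS]mulN1r; congr (_ * _); apply/eqP; rewrite eq_complex /=.
  by rewrite cosN sinN cospi sinpi oppr0 !eqxx.
(* The power [m] is held fixed while factors are added, so that one element is an eigenvector of all
   of them. *)
suff h m j : (j <= m)%N -> partial_twist j.+2 * (s1 * s1 * s2 ^+ m) =
    phase (- pi + pi / 2 ^+ j.+1) *: (s1 * s1 * s2 ^+ m).
  by rewrite h // phasepi.
elim: j => [|j IH] jm.
  have -> : partial_twist 2 = factor 0 * factor 1 by rewrite /= mul1r.
  have e1 : parity 1 * (s1 * s1 * s2 ^+ m) = s1 * s1 * s2 ^+ m.
    by rewrite mulrA parity1_s1s1.
  have e0 : parity 0 * (s1 * s1 * s2 ^+ m) = - (s1 * s1 * s2 ^+ m).
    by rewrite mulrA (mulrA (parity 0) s1) parity0_s1 !mulNr.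
  rewrite -(mulrA (factor 0)) (rotation_eigen _ e1) -scalerAr.
  by rewrite (rotation_eigenN _ e0) scalerA mulrC -phaseD expr0 divr1.
have e : parity j.+2 * (s1 * s1 * s2 ^+ m) = - (s1 * s1 * s2 ^+ m).
  by rewrite mulrA parity_s1s1 -(mulrA (s1 * s1)) unshift_parity_exp // mulrN.
rewrite [partial_twist _]/= -mulrA (rotation_eigenN _ e) -scalerAr.
rewrite IH; last exact: ltnW.
rewrite scalerA -phaseD; congr (phase _ *: _).
by rewrite addrCA; congr (_ + _); rewrite !exprS; field; rewrite expf_neq0.
Qed.

Lemma D2_twist_exists : exists f, [/\ D f, unitary f,
  f * (u * f * star u) * s2 = s2 * f & f * s1 * s1 <> s1 * s1].
Proof.
have [f [fl [K fK]]] := partial_twist_cvg.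
exists f; split.
- exact (subalg_cvg (D2_subalgebra _ _) D2_partial_twist fl).
- split.
    apply: norm_cvg_uniq (norm_cvgM (norm_cvg_star fl) fl) _.
    under eq_fun do rewrite (unitary_partial_twist _).1.
    exact: norm_cvg_cst.
  apply: norm_cvg_uniq (norm_cvgM fl (norm_cvg_star fl)) _.
  under eq_fun do rewrite (unitary_partial_twist _).2.
  exact: norm_cvg_cst.
- have fl' := norm_cvg_shift fl.
  have h := norm_cvgMr s2
    (norm_cvgM fl' (norm_cvgMr (star u) (norm_cvgMl u fl'))).
  apply: norm_cvg_uniq h _.
  under eq_fun do rewrite partial_twist_s2.
  exact: norm_cvgMl.
move=> fs.
(* If [f] fixed [s1 s1], then the partial product would send the isometry [v] close to [v], while it
   sends it close to [- v]; but [2 v] has norm 2. *)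
have bound k : 2 <= (K + 2 * pi) * 2^-1 ^+ k.
  set v := s1 * s1 * s2 ^+ k.
  have vv : Defs.isometry v.
    have s11 := letter_isometry s12 false.
    exact (isometryM (isometryM s11 s11) (isometryX k s22)).
  have h1 : cnorm (partial_twist k.+2 * v - v) <= K * 2^-1 ^+ k.
    have fv : f * v = v by rewrite /v mulrA (mulrA f s1) fs.
    rewrite -{2}fv -mulrBl (le_trans (cnormM _ _)) // (cnorm_isometry vv) mulr1.
    rewrite (le_trans (fK _)) // ler_wpM2l //.
      by have := fK 0%N; rewrite expr0 mulr1; apply: le_trans; exact: cnorm_ge0.
    by rewrite !exprS mulrA ler_piMl // ?exprn_ge0 ?invr_ge0 //; lra.
  set th : R := pi / 2 ^+ k.+1.
  have h2 : cnorm (phase th *: v - v) <= 2 * pi * 2^-1 ^+ k.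
    have th0 : 0 <= th by rewrite divr_ge0 ?pi_ge0 // exprn_ge0.
    have -> : phase th *: v - v = (rotation th 1 - 1) * v.
      by rewrite mulrBl (rotation_eigen _ (mul1r v)) mul1r.
    rewrite (le_trans (cnormM _ _)) // (cnorm_isometry vv) mulr1.
    rewrite (le_trans (rotation_sub1 th0 _)) ?cnorm1 //.
    rewrite /th exprS invfM exprVn -mulrA ler_wpM2l // ler_wpM2l ?pi_ge0 //.
    by rewrite ler_piMl ?invr_ge0 ?exprn_ge0 //; lra.
  move: h1; rewrite partial_twist_eigen -/v scaleNr => h1.
  have {1}-> : 2 = cnorm ((- (phase th *: v) - v) + (phase th *: v - v)) :> R.
    rewrite addrACA addNr add0r -opprD cnormN -(mulr2n v) -(scaler_nat 2 v).
    rewrite cnormZ (cnorm_isometry vv) mulr1.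
    rewrite -[X in Normc.normc X](rmorph_nat (real_complex R)).
  by rewrite normc_real normr_nat.
  by rewrite (le_trans (cnormD _ _)) // mulrDl lerD.
have : 2 <= 0 :> R.
  apply: (ler_cvg_to (@cvg_cst _ _ _ _ _) (cvg_half (K + 2 * pi))).
  by near=> k; exact: bound.
by lra.
Unshelve. all: end_near. Qed.

(** * Endomorphisms of the 2-adic ring algebra given by a twist *)

Section Extension.
Variable f : A.
Hypotheses (Df : D f) (uf : unitary f).
Hypothesis fE : f * (u * f * star u) * s2 = s2 * f.

(** The functional equation is exactly the relation [s2 (f u) = (f u)^2 s2]; the range relation
    persists because [f] commutes with [s1 s1^*]. *)
Lemma Q2_relations_twist : Q2_relations (f * u) s2.
Proof.
case: rel => uU iso2 us sum1; split=> //.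
- exact: unitaryM.
- rewrite mulrA -fE -(mulrA _ s2) us !mulrA -(mulrA _ (star u)).
  by rewrite expr2 !mulrA -(mulrA _ (star u)) uu' mulr1.
have [_ ff] := uf.
have -> : f * u * s2 * star s2 * star (f * u) = f * (s1 * star s1) * star f.
  by rewrite !starM !mulrA.
have Dq : D (s1 * star s1) := D2_letter_proj false.
rewrite (D2_comm s12 Df Dq) -mulrA ff mulr1.
by rewrite starM !mulrA.
Qed.

(** The conjugate of a solution is a solution; it provides the inverse automorphism. *)
Lemma twist_star : star f * (u * star f * star u) * s2 = s2 * star f.
Proof.
have [f1 f2] := uf; move: fE; set g := u * f * star u => gE.
have Dg : D g by exact: D2_shift.
have [g1 _] : unitary g.
  by apply: unitaryM; [apply: unitaryM|exact: unitary_star].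
have <- : star g = u * star f * star u by rewrite /g !starM starK !mulrA.
have DD := D2_subalgebra s1 s2; clearbody g.
rewrite (D2_comm s12 (subalg_star DD Df) (subalg_star DD Dg)).
have : star g * star f * (f * g * s2) * star f =
    star g * star f * (s2 * f) * star f.
  by rewrite gE.
rewrite !mulrA -(mulrA _ (star f) f) f1 mulr1 g1 mul1r => ->.
by rewrite -(mulrA _ f) f2 mulr1.
Qed.

Variable L : A -> A.
Hypotheses (Lh : star_hom setT L) (Lu : L u = f * u) (L2 : L s2 = s2).

Let Lb := star_hom_bounded Lh.

Lemma twist_s1 : L s1 = f * s1.
Proof. by case: Lb => _ _ LM _ _; rewrite LM Lu L2 mulrA. Qed.

(** By induction on the word: a letter 1 contributes conjugation by [f], which is trivial on the
    commutative algebra [D]. *)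
Lemma twist_fix_D2 x : D x -> L x = x.
Proof.
have [_ _ LM Ls _] := Lb; have [_ _ _ _ L1] := Lh.
apply: (bounded_hom_fix Lb) => _ [mu ->].
elim: mu => [|b mu IH]; first by rewrite s_word_nil star1 mulr1 L1.
rewrite s_word_proj_cons.
move: (_ * star _) (D2_word (s1 := s1) (s2 := s2) mu) IH => y Dy Ly.
have := D2_letter_conj s12 b Dy.
rewrite LM LM Ls Ly; case: b => Dp; first by rewrite L2.
rewrite twist_s1; have [_ ff] := uf.
have -> : f * s1 * y * star (f * s1) = f * (s1 * y * star s1) * star f.
  by rewrite !starM !mulrA.
by rewrite (D2_comm s12 Df Dp) -mulrA ff mulr1.
Qed.

Lemma twist_O2 x : O x -> O (L x).
Proof.
apply: (bounded_hom_gen Lb (O2_subalgebra _ _)) => _ [->|->].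
  rewrite twist_s1.
  exact (subalgM (O2_subalgebra _ _) (O2_D2 s12 Df) (O2_letter false)).
by rewrite L2; exact (O2_letter true).
Qed.

End Extension.

(** [L'] fixes [f], so [L'(L u) = f f' u = u], and [u], [s2] generate. *)
Lemma twist_comp f f' (L L' : A -> A) :
  D f -> unitary f' -> D f' -> f * f' = 1 ->
  star_hom setT L -> L u = f * u -> L s2 = s2 ->
  star_hom setT L' -> L' u = f' * u -> L' s2 = s2 ->
  cstar_gen [set u; s2] = setT -> forall x, L' (L x) = x.
Proof.
move=> Df uf' Df' ff' Lh Lu L2 Lh' Lu' L2' gen x.
have Lb := star_hom_bounded Lh; have Lb' := star_hom_bounded Lh'.
have : cstar_gen [set u; s2] x by rewrite gen.
apply: (bounded_hom_fix (bounded_hom_comp Lb' Lb)) => _ [->|->] /=; last first.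
  by rewrite L2.
have [_ _ LM' _ _] := Lb'.
by rewrite Lu LM' Lu' (twist_fix_D2 Df' uf' Lh' Lu' L2' Df) mulrA ff' mul1r.
Qed.

End TwoAdic.

(** * The automorphism [lambda_d] and its properties *)

Theorem theorem1p3 (R : realType) (Q2 : cstarAlgType R) (u s2 : Q2)
    (hQ2 : is_Q2 u s2) :
  let s1 := u * s2 in
  exists d : Q2,
    [/\ D2 s1 s2 d, unitary d
      & exists lambda_d : Q2 -> Q2,
          [/\ is_lambda s1 s2 d lambda_d,
              star_aut (O2 s1 s2) lambda_d,
              (exists Lambda : Q2 -> Q2,
                 star_aut setT Lambda /\
                 (forall x, O2 s1 s2 x -> Lambda x = lambda_d x)),
              (forall x, cstar_gen (D2 s1 s2 `|` [set s2]) x -> lambda_d x = x)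
            & ~ generated_subgroup (O2 s1 s2) (flip_gauge_inner s1 s2)
                  lambda_d]].
Proof.
move=> s1; case: hQ2 => rel gen univ.
have s12 : cuntz_pair s1 s2 := Q2_cuntz_pair rel.
have DD := D2_subalgebra s1 s2.
have [f [Df uf fE fn1]] := D2_twist_exists rel.
have Dsf := subalg_star DD Df; have usf := unitary_star uf.
have [L [Lh Lu L2]] := univ _ _ _ (Q2_relations_twist rel Df uf fE).
have [L' [Lh' Lu' L2']] :=
  univ _ _ _ (Q2_relations_twist rel Dsf usf (twist_star rel Df uf fE)).
have [sff ffs] := uf.
have LK : cancel L L'.
  exact (twist_comp rel Df usf Dsf ffs Lh Lu L2 Lh' Lu' L2' gen).
have LK' : cancel L' L.
  exact (twist_comp rel Dsf uf Df sff Lh' Lu' L2' Lh Lu L2 gen).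
have LO := twist_O2 rel Df Lh Lu L2; have LO' := twist_O2 rel Dsf Lh' Lu' L2'.
have Lfix := twist_fix_D2 rel Df uf Lh Lu L2.
have L1 := twist_s1 Lh Lu L2.
have Os1 : O2 s1 s2 s1 := O2_letter false.
have LhO : star_hom (O2 s1 s2) L.
  have [LD LZ LM Ls L01] := Lh.
  split=> // [x y _ _|a x _|x y _ _|x _];
    [exact: LD|exact: LZ|exact: LM|exact: Ls].
have [s11 s22 sum1] := s12.
have s21 : star s2 * s1 = 0 := letter_star s12 true false.
have os21 : star s1 * s2 = 0 := letter_star s12 false true.
set q1 := s1 * star s1; set q2 := s2 * star s2.
have Dq1 : D2 s1 s2 q1 := D2_letter_proj false.
have Dq2 : D2 s1 s2 q2 := D2_letter_proj true.
(* [d] has to satisfy [d s1 = f s1] and [d s2 = s2]: it is [f] on the range of [s1] and 1 on the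
   range of [s2]. *)
exists (f * q1 + q2); split.
- exact (subalgD DD (subalgM DD Df Dq1) Dq2).
- have q11 : q1 * q1 = q1 by rewrite /q1 mulrA -(mulrA s1) s11 mulr1.
  have q22 : q2 * q2 = q2 by rewrite /q2 mulrA -(mulrA s2) s22 mulr1.
  have q12 : q1 * q2 = 0 by rewrite /q1 /q2 mulrA -(mulrA s1) os21 mulr0 mul0r.
  have q21 : q2 * q1 = 0 by rewrite /q1 /q2 mulrA -(mulrA s2) s21 mulr0 mul0r.
  have q1s : star q1 = q1 by rewrite /q1 [LHS]starM starK.
  have q2s : star q2 = q2 by rewrite /q2 [LHS]starM starK.
  have fq1 := D2_comm s12 Df Dq1; have fq2 := D2_comm s12 Df Dq2.
  have sfq1 := D2_comm s12 Dsf Dq1; have sum' : q1 + q2 = 1 by [].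
  clearbody q1 q2.
  split; rewrite starD starM q1s q2s mulrDl !mulrDr q22.
    rewrite -!mulrA (mulrA (star f) f) sff mul1r q11 fq1 (mulrA q2) q21.
    rewrite (mulrA q1 (star f)) -sfq1 -(mulrA (star f)) q12.
    by rewrite mulr0 mul0r addr0 add0r.
  rewrite -!mulrA (mulrA q1 q1) q11 -sfq1 (mulrA f) ffs mul1r q12 mulr0.
  by rewrite sfq1 (mulrA q2) q21 mul0r addr0 add0r.
exists L; split.
- split; first by split.
    by rewrite mulrDl -!mulrA s11 s21 !mulr0 addr0 mulr1 L1.
  by rewrite mulrDl -!mulrA s22 os21 !mulr0 add0r mulr1 L2.
- split=> //; split=> //; first by move=> x y _ _; exact: can_inj.
  by move=> x Ox; exists (L' x) => //; exact: LO'.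
- exists L; split=> //; split=> //; split=> // [x y _ _|x _].
    exact: can_inj.
  by exists (L' x).
- move=> x; apply: (bounded_hom_fix (star_hom_bounded Lh)) => y [Dy|->] //.
  exact: Lfix.
(* [L] fixes [s2] and [s1 s1^*], so membership would force [f s1 s1 = s1 s1]. *)
move=> /(generated_corner s12) /(_ L2 (Lfix _ Dq1)).
by rewrite L1 => /fn1.
Qed.
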